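(* Let $d\ge2$, $p\in(d,\infty)$, and let $A=(a_{ij})_{1\le i,j\le d}$ be a symmetric matrix of functions on $\mathbb R^d$ with $a_{ij}\in H^{1,p}_{loc}(\mathbb R^d)\cap C(\mathbb R^d)$ for all $1\le i,j\le d$, which is locally uniformly strictly elliptic, i.e. for each open ball $B\subset\mathbb R^d$ there exist constants $\lambda_B,\Lambda_B>0$ such that $\lambda_B\|\xi\|^2\le\langle A(x)\xi,\xi\rangle\le\Lambda_B\|\xi\|^2$ for all $x\in B$ and $\xi\in\mathbb R^d$. Then there exists a (unique) lower triangular matrix of functions $\sigma=(\sigma_{ij})_{1\le i,j\le d}$ with $\sigma_{ij}\in H^{1,p}_{loc}(\mathbb R^d)\cap C(\mathbb R^d)$ for all $1\le i,j\le d$ and $\sigma_{ii}>0$ on $\mathbb R^d$ for all $1\le i\le d$ such that $$A=\sigma\sigma^T\quad\text{on }\mathbb R^d.$$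
   Context: $H^{1,p}_{loc}(\mathbb R^d)$ is the set of functions whose restriction to every bounded open set $W$ lies in $L^p(W)$ together with its first-order weak partial derivatives. $C(\mathbb R^d)$ is the set of continuous functions. *)

(* Defs.v *)
From HB Require Import structures.
From mathcomp Require Import all_boot all_order all_algebra.
From mathcomp Require Import all_classical all_reals all_analysis.

Set Implicit Arguments.
Unset Strict Implicit.
Unset Printing Implicit Defensive.
Import Order.TTheory GRing.Theory Num.Theory.
Import numFieldNormedType.Exports.
Local Open Scope classical_set_scope.
Local Open Scope ring_scope.

(* R^n is 'rV[R]_n, with the sigma-algebra generated by the coordinates, i.e.
   the product (Borel) sigma-algebra. *)
Definition rV_display : measure_display. Proof. exact. Qed.

Section measurable_rV.
Context (R : realType) (n : nat).

Definition rV_coord (i : 'I_n) (x : 'rV[R]_n) : measurableTypeR R := x ord0 i.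

Let rV_set0 : g_sigma_preimage rV_coord set0.
Proof. exact: sigma_algebra0. Qed.

Let rV_setC A : g_sigma_preimage rV_coord A -> g_sigma_preimage rV_coord (~` A).
Proof. exact: sigma_algebraC. Qed.

Let rV_bigcup (F : (set 'rV[R]_n)^nat) :
  (forall i, g_sigma_preimage rV_coord (F i)) ->
  g_sigma_preimage rV_coord (\bigcup_i (F i)).
Proof. exact: sigma_algebra_bigcup. Qed.

HB.instance Definition _ := @isMeasurable.Build rV_display
  'rV[R]_n (g_sigma_preimage rV_coord) rV_set0 rV_setC rV_bigcup.

Lemma measurable_rV_coord (i : 'I_n) : measurable_fun [set: 'rV[R]_n] (rV_coord i).
Proof.
move=> _ Y mY; rewrite setTI; apply: sub_sigma_algebra => /=.
rewrite -bigcup_seq/=; exists i => /=; first by rewrite mem_index_enum.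
by exists Y => //; rewrite setTI.
Qed.

Lemma measurable_fun_rVP d (T : measurableType d) (f : T -> 'rV[R]_n) :
  (forall i, measurable_fun [set: T] (rV_coord i \o f)) ->
  measurable_fun [set: T] f.
Proof.
move=> mf _ A mA; rewrite setTI.
have : preimage_set_system [set: T] f (g_sigma_preimage rV_coord) (f @^-1` A).
  by exists A => //; rewrite setTI.
have sub : g_sigma_preimage (fun i => rV_coord i \o f) `<=` measurable.
  apply: smallest_sub; first exact: sigma_algebra_measurable.
  rewrite -bigcup_seq; apply: bigcup_sub => i _ _ [B mB <-].
  exact: mf.
by rewrite -(@g_sigma_preimage_comp _ _ n ('rV[R]_n)) => /sub.
Qed.

End measurable_rV.

Section lebesgue_rV.
Context (R : realType).

Definition rV_cons n (x : measurableTypeR R * 'rV[R]_n) : 'rV[R]_n.+1 :=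
  \row_i (if unlift ord0 i is Some j then x.2 ord0 j else x.1).

Lemma measurable_rV_cons n : measurable_fun setT (@rV_cons n).
Proof.
apply: measurable_fun_rVP => i.
case: (unliftP ord0 i) => [j|] ->.
  rewrite (_ : _ \o _ = rV_coord j \o snd); last first.
    by apply/funext => x; rewrite /= /rV_coord mxE liftK.
  by apply: measurableT_comp => //; exact: measurable_rV_coord.
rewrite (_ : _ \o _ = fst) //.
by apply/funext => x; rewrite /= /rV_coord mxE unlift_none.
Qed.

Section step.
Context (n : nat) (mu : {sigma_finite_measure set 'rV[R]_n -> \bar R}).

Definition lebesgue_rVS : set 'rV[R]_n.+1 -> \bar R :=
  pushforward (@lebesgue_measure R \x mu)%E (@rV_cons n).


Let lebesgue_rVS0 : lebesgue_rVS set0 = 0%E.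
Proof. by rewrite /lebesgue_rVS /pushforward preimage_set0 measure0. Qed.

Let lebesgue_rVS_ge0 A : (0 <= lebesgue_rVS A)%E.
Proof. by rewrite /lebesgue_rVS /pushforward; exact: measure_ge0. Qed.

Let lebesgue_rVS_sigma_additive : semi_sigma_additive lebesgue_rVS.
Proof.
move=> F mF tF mUF; rewrite /lebesgue_rVS /pushforward preimage_bigcup.
have mcons A : measurable A -> measurable (@rV_cons n @^-1` A).
  by move=> mA; rewrite -[X in measurable X]setTI; exact: measurable_rV_cons.
apply: measure_semi_sigma_additive.
- by move=> k; exact: mcons.
- apply/trivIsetP => /= i j _ _ ij; rewrite -preimage_setI.
  by move/trivIsetP : tF => /(_ _ _ _ _ ij) ->//; rewrite preimage_set0.
- by rewrite -preimage_bigcup; exact: mcons.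
Qed.

HB.instance Definition _ := isMeasure.Build _ _ _ lebesgue_rVS
  lebesgue_rVS0 lebesgue_rVS_ge0 lebesgue_rVS_sigma_additive.

Let lebesgue_rVS_sigma_finite : sigma_finite setT lebesgue_rVS.
Proof.
have /sigma_finiteP[F [TF ndF Foo]] := sigma_finiteT (@lebesgue_measure R).
have /sigma_finiteP[G [TG ndG Goo]] := sigma_finiteT mu.
pose uncons (x : 'rV[R]_n.+1) : measurableTypeR R * 'rV[R]_n :=
  (rV_coord ord0 x, \row_j x ord0 (lift ord0 j)).
have muncons : measurable_fun setT uncons.
  apply: measurable_fun_pair; first exact: measurable_rV_coord.
  apply: measurable_fun_rVP => j.
  rewrite (_ : _ \o _ = rV_coord (lift ord0 j)); first exact: measurable_rV_coord.
  by apply/funext => x; rewrite /= /rV_coord mxE.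
have consK : cancel (@rV_cons n) uncons.
  move=> [a x]; rewrite /uncons /rV_coord mxE unlift_none; congr pair.
  by apply/rowP => j; rewrite !mxE liftK.
have pushE A B : lebesgue_rVS (uncons @^-1` (A `*` B)) =
    (@lebesgue_measure R \x mu)%E (A `*` B).
  rewrite /lebesgue_rVS /pushforward -comp_preimage (_ : _ \o _ = id) //.
  exact/funext.
exists (fun k => uncons @^-1` (F k `*` G k)).
  apply/esym; rewrite -subTset => x _.
  have [k _ Fk] : (\bigcup_k F k) (uncons x).1 by rewrite -TF.
  have [l _ Gl] : (\bigcup_l G l) (uncons x).2 by rewrite -TG.
  exists (maxn k l) => //; split.
    by move: Fk; exact/subsetPset/ndF/leq_maxl.
  by move: Gl; exact/subsetPset/ndG/leq_maxr.
move=> k; have [mF Fkoo] := Foo k; have [mG Gkoo] := Goo k; split.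
  rewrite -[X in measurable X]setTI; apply: muncons => //.
  exact: measurableX.
by rewrite pushE product_measure1E// lte_mul_pinfty// ge0_fin_numE.
Qed.

HB.instance Definition _ := Measure_isSigmaFinite.Build _ _ _ lebesgue_rVS
  lebesgue_rVS_sigma_finite.

End step.

Fixpoint lebesgue_rV n : {sigma_finite_measure set 'rV[R]_n -> \bar R} :=
  match n with
  | 0%N => \d_(0 : 'rV[R]_0)
  | n'.+1 => lebesgue_rVS (lebesgue_rV n')
  end.

Lemma lebesgue_rV_box n (B : 'I_n -> set (measurableTypeR R)) :
  (forall i, measurable (B i)) ->
  lebesgue_rV n [set x | forall i, B i (x ord0 i)] =
  (\prod_(i < n) lebesgue_measure (B i))%E.
Proof.
elim: n B => [|n IH] B mB.
  by rewrite big_ord0 /= diracE mem_set //= => -[].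
have mbox : measurable [set x : 'rV[R]_n | forall i, B (lift ord0 i) (x ord0 i)].
  rewrite (_ : mkset _ = \bigcap_(i in [set: 'I_n])
      (@rV_coord R n i @^-1` (B (lift ord0 i)))); last first.
    by apply/seteqP; split => x /= h i; [move=> _|]; exact: h.
  apply: fin_bigcap_measurable => // i _; rewrite -[X in measurable X]setTI.
  exact: measurable_rV_coord.
rewrite big_ord_recl -IH //= /lebesgue_rVS /pushforward.
rewrite -[RHS]product_measure1E //.
congr (_ _); apply/seteqP; split => -[a x] /=.
  move=> h; split; first by move: (h ord0); rewrite mxE unlift_none.
  by move=> i; move: (h (lift ord0 i)); rewrite mxE liftK.
move=> [Ba Bx] i; rewrite mxE.
by case: (unliftP ord0 i) => [j|] ->.
Qed.

End lebesgue_rV.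

Section sobolev.
Context (R : realType) (d : nat).
Implicit Types (f g phi : 'rV[R]_d -> R) (W : set 'rV[R]_d).

Definition partial (i : 'I_d) f : 'rV[R]_d -> R := 'D_(delta_mx ord0 i) f.

Fixpoint Ck (k : nat) f : Prop :=
  continuous f /\
  if k is k'.+1 then
    forall i, (forall x, derivable f x (delta_mx ord0 i)) /\ Ck k' (partial i f)
  else True.

Definition smooth f := forall k, Ck k f.

(* phi in C_c^oo(W), extended by 0 to R^d *)
Definition test_fun W phi :=
  [/\ smooth phi, compact (closure [set x | phi x != 0]) &
      closure [set x | phi x != 0] `<=` W].

(* Only the values of f on W matter. *)
Definition Lp_on (p : R) W f :=
  measurable_fun W f /\
  finite_norm (@lebesgue_rV R d) p%:E (fun x => \1_W x * f x).

Definition weak_partial W (i : 'I_d) f g :=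
  forall phi, test_fun W phi ->
    \int[@lebesgue_rV R d]_(x in W) (f x * partial i phi x) =
    - \int[@lebesgue_rV R d]_(x in W) (g x * phi x).

Definition H1p_loc (p : R) f :=
  forall W, open W -> bounded_set W ->
    Lp_on p W f /\
    forall i, exists g, Lp_on p W g /\ weak_partial W i f g.

Definition dotr (u v : 'rV[R]_d) : R := \sum_i u ord0 i * v ord0 i.

(* The norm of 'rV[R]_d is the maximum norm, hence a separate definition of
   Euclidean balls. *)
Definition eball (c : 'rV[R]_d) (r : R) : set 'rV[R]_d :=
  [set x | dotr (x - c) (x - c) < r ^+ 2].

(* Vectors being rows, A(x) xi is xi *m (A x)^T. *)
Definition loc_unif_strictly_elliptic (A : 'rV[R]_d -> 'M[R]_d) :=
  forall c r, 0 < r ->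
    exists lam Lam : R, [/\ 0 < lam, 0 < Lam &
      forall x xi, eball c r x ->
        lam * dotr xi xi <= dotr (xi *m (A x)^T) xi <= Lam * dotr xi xi].

End sobolev.

(* Main.v *)
(* The entries of the Cholesky factor arise from those of A by subtractions,
   products, and inverses and square roots of positive functions (Schur
   complements), so it is enough that the continuous functions in H^{1,p}_loc
   are stable under these operations.  For p >= 1 this follows from a chain rule:
   if U = F o f and m = F' o f are continuous with
   |U(y) - U(x) - m(x)(f(y) - f(x))| <= C |f(y) - f(x)|^2 on bounded sets, and g is
   a weak partial derivative of f in direction e, then m g is one of U.

   No mollification is needed.  With d_h f(x) = f(x - h e) - f(x) one has
   \int U d_e phi = lim 1/h \int phi d_h U and 1/h \int psi d_h f -> - \int psi g
   for psi continuous with compact support.  The latter reduces to test functions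
   by uniform approximation, thanks to |\int psi d_h f| <= h sup|psi| \int |g|.
   The same estimate for psi = |phi| d_h f shows that \int |phi| (d_h f)^2 = o(h),
   because d_h f tends to 0 uniformly on bounded sets; hence the quadratic
   remainder does not contribute to the limit. *)
Require Import Defs.
From HB Require Import structures.
From mathcomp Require Import all_boot all_order all_algebra.
From mathcomp Require Import all_classical all_reals all_analysis.
From mathcomp Require Import measurable_realfun.
From mathcomp Require Import ring lra.

Set Implicit Arguments.
Unset Strict Implicit.
Unset Printing Implicit Defensive.
Import Order.TTheory GRing.Theory Num.Theory.
Import numFieldNormedType.Exports.
Local Open Scope classical_set_scope.
Local Open Scope ring_scope.

(** * Cholesky factorization *)

Section cholesky.
Context (R : rcfType).

Lemma is_trig_block_mx11 n (a : 'M[R]_1) b c (M : 'M[R]_n) :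
  is_trig_mx (block_mx a b c M) = (b == 0) && is_trig_mx M.
Proof.
apply/is_trig_mxP/andP => [trig|[/eqP -> /is_trig_mxP trig] i j].
  split; last first.
    apply/is_trig_mxP => i j ij.
    by have := trig (rshift 1 i) (rshift 1 j); rewrite block_mxEdr; apply.
  apply/eqP/matrixP => i j; rewrite mxE.
  have := trig (lshift n i) (rshift 1 j); rewrite block_mxEur; apply.
  by rewrite ord1.
case: (split_ordP i) => i' ->; case: (split_ordP j) => j' ->; rewrite ?ord1//=.
- by rewrite block_mxEur mxE.
- by rewrite block_mxEdr; exact: trig.
Qed.

(** Induction on the size, comparing blocks: the corners have equal squares and positive sign, so
    they agree; the first column below the corner is then found by cancelling the invertible corner;
    subtracting its contribution leaves the same equation for the lower right blocks. *)
Lemma cholesky_unique n (L M : 'M[R]_n) :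
  is_trig_mx L -> is_trig_mx M ->
  (forall i, 0 < L i i) -> (forall i, 0 < M i i) ->
  L *m L^T = M *m M^T -> L = M.
Proof.
elim: n L M => [L M _ _ _ _ _|n IH]; first by rewrite [LHS]flatmx0 [RHS]flatmx0.
(* The size is displayed as [1 + n] so that block decompositions apply. *)
change (forall L M : 'M[R]_(1 + n), is_trig_mx L -> is_trig_mx M ->
  (forall i, 0 < L i i) -> (forall i, 0 < M i i) ->
  L *m L^T = M *m M^T -> L = M) => L M.
rewrite -[L]submxK -[M]submxK.
set l := ulsubmx L; set u := dlsubmx L; set L' := drsubmx L.
set m := ulsubmx M; set v := dlsubmx M; set M' := drsubmx M.
rewrite !is_trig_block_mx11 => /andP[/eqP -> trigL] /andP[/eqP -> trigM].
move=> posL posM; rewrite !tr_block_mx !mulmx_block !trmx0 !mulmx0 !mul0mx.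
rewrite !addr0 => /eq_block_mx[ll _ ul LL].
have posl : 0 < l 0 0.
  by have := posL (lshift n 0); rewrite block_mxEul.
have posm : 0 < m 0 0.
  by have := posM (lshift n 0); rewrite block_mxEul.
have lm : l = m.
  have sq (N : 'M[R]_1) : (N *m N^T) 0 0 = N 0 0 ^+ 2.
    by rewrite !mxE big_ord1 mxE expr2.
  apply/matrixP => i j; rewrite !ord1; move/matrixP : ll => /(_ 0 0).
  by rewrite !sq => /eqP; rewrite eqrXn2 ?ltW// => /eqP.
have uv : u = v.
  have unitl : l^T \in unitmx by rewrite unitmxE det_tr det_mx11 unitfE gt_eqF.
  by rewrite -[u](mulmxK unitl) ul -lm mulmxK.
rewrite lm uv; congr block_mx; apply: IH => //.
- by move=> i; have := posL (rshift 1 i); rewrite block_mxEdr.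
- by move=> i; have := posM (rshift 1 i); rewrite block_mxEdr.
- by move: LL; rewrite uv => /addrI.
Qed.

(** For fixed [w], the full quadratic form at (t, w) is minimal in t at t = - a^-1 w v^T. There the
    first block of the product vanishes and the Schur complement form at [w] remains. *)
Lemma schur_posdef n (a : R) (v : 'rV[R]_n) (B : 'M[R]_n) :
  0 < a ->
  (forall u : 'rV[R]_(1 + n), u != 0 ->
    0 < (u *m block_mx a%:M v v^T B *m u^T) 0 0) ->
  forall w : 'rV[R]_n, w != 0 ->
    0 < (w *m (B - a^-1 *: (v^T *m v)) *m w^T) 0 0.
Proof.
move=> a0 pd w w0.
pose t : 'M[R]_1 := - a^-1 *: (w *m v^T).
have /pd : row_mx t w != 0.
  by apply: contra_neq w0 => /(congr1 rsubmx); rewrite row_mxKr linear0.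
suff -> : row_mx t w *m block_mx a%:M v v^T B =
    row_mx 0 (w *m (B - a^-1 *: (v^T *m v))).
  by rewrite tr_row_mx mul_row_col mul0mx add0r.
rewrite mul_row_block; congr row_mx.
  by rewrite mul_mx_scalar scalerA mulrN divff ?gt_eqF// scaleN1r addNr.
by rewrite mulmxBr -scalemxAr mulmxA /t -scalemxAl scaleNr addrC.
Qed.

Section class.
Context (T : Type) (C : (T -> R) -> Prop).
Hypotheses (C0 : C (fun=> 0))
  (CB : forall f g, C f -> C g -> C (fun x => f x - g x))
  (CM : forall f g, C f -> C g -> C (fun x => f x * g x))
  (CV : forall f, (forall x, 0 < f x) -> C f -> C (fun x => (f x)^-1))
  (Csqrt : forall f, (forall x, 0 < f x) -> C f -> C (fun x => Num.sqrt (f x))).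

(** The recursive Cholesky algorithm run on matrices of functions: the first column comes from the
    corner and the first row, the rest from factoring the Schur complement. The class [C] abstracts
    from regularity and is later taken to be the continuous functions in H^{1,p}_loc. *)
Lemma cholesky_in_class n (A : T -> 'M[R]_n) :
  (forall x, (A x)^T = A x) ->
  (forall x (v : 'rV[R]_n), v != 0 -> 0 < (v *m A x *m v^T) 0 0) ->
  (forall i j, C (fun x => A x i j)) ->
  exists S : T -> 'M[R]_n,
    [/\ forall x, is_trig_mx (S x), forall i j, C (fun x => S x i j),
        forall i x, 0 < S x i i & forall x, A x = S x *m (S x)^T].
Proof.
elim: n A => [A _ _ _|n IH].
  exists A; split; [| |by case|] => [x|[]//|x]; last by rewrite [LHS]flatmx0 [RHS]flatmx0.
  by apply/is_trig_mxP => -[].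
change (forall A : T -> 'M[R]_(1 + n), (forall x, (A x)^T = A x) ->
  (forall x (v : 'rV[R]_(1 + n)), v != 0 -> 0 < (v *m A x *m v^T) 0 0) ->
  (forall i j, C (fun x => A x i j)) ->
  exists S : T -> 'M[R]_(1 + n),
    [/\ forall x, is_trig_mx (S x), forall i j, C (fun x => S x i j),
        forall i x, 0 < S x i i & forall x, A x = S x *m (S x)^T]) => A symA pdA CA.
pose a x := A x (lshift n 0) (lshift n 0).
pose v x : 'rV[R]_n := ursubmx (A x).
pose B x : 'M[R]_n := drsubmx (A x).
have AE x : A x = block_mx (a x)%:M (v x) (v x)^T (B x).
  rewrite -[LHS]submxK; congr block_mx.
    by apply/matrixP => i j; rewrite !ord1 !mxE eqxx.
  by rewrite trmx_ursub symA.
have a0 x : 0 < a x.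
  (* The corner is the value of the form at the first basis vector. *)
  have /(pdA x) : (row_mx 1%:M 0 : 'rV[R]_(1 + n)) != 0.
    apply/eqP => /(congr1 lsubmx); rewrite row_mxKl linear0 => /matrixP/(_ 0 0).
    by rewrite !mxE => /eqP; rewrite oner_eq0.
  rewrite AE mul_row_block !mul0mx !addr0 !mul1mx tr_row_mx mul_row_col.
  by rewrite trmx0 mulmx0 addr0 trmx1 mulmx1 mxE eqxx.
have Ca : C a by exact: CA.
have Cv j : C (fun x => v x 0 j).
  by rewrite (_ : (fun=> _) = fun x => A x (lshift n 0) (rshift 1 j)) //;
    apply/funext => x; rewrite !mxE.
have CB' i j : C (fun x => B x i j).
  by rewrite (_ : (fun=> _) = fun x => A x (rshift 1 i) (rshift 1 j)) //;
    apply/funext => x; rewrite !mxE.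
have [|x|i j|S [trigS CS posS SE]] := IH (fun x => B x - (a x)^-1 *: ((v x)^T *m v x)).
- move=> x; rewrite linearB /= linearZ /= trmx_mul trmxK.
  by rewrite /B trmx_drsub symA.
- by apply: schur_posdef => // u u0; rewrite -AE; exact: pdA.
- rewrite (_ : (fun=> _) = fun x => B x i j - (a x)^-1 * (v x 0 i * v x 0 j)).
    by apply: CB => //; apply: CM; [exact: CV|exact: CM].
  by apply/funext => x; rewrite !mxE big_ord1 !mxE.
(* In the product, the column v^T / sqrt a contributes a^-1 v^T v to the lower right block, which is
   exactly what the Schur complement had removed from [B]. *)
exists (fun x => block_mx (Num.sqrt (a x))%:M 0 ((Num.sqrt (a x))^-1 *: (v x)^T) (S x)).
have sqrt0 x : 0 < Num.sqrt (a x) by rewrite sqrtr_gt0.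
split.
- by move=> x; rewrite is_trig_block_mx11 eqxx trigS.
- move=> i j; case: (split_ordP i) => i' ->; case: (split_ordP j) => j' ->.
  + rewrite (_ : (fun=> _) = fun x => Num.sqrt (a x)); first exact: Csqrt.
    by apply/funext => x; rewrite block_mxEul !ord1 mxE eqxx.
  + rewrite (_ : (fun=> _) = fun=> 0) //.
    by apply/funext => x; rewrite block_mxEur mxE.
  + rewrite (_ : (fun=> _) = fun x => (Num.sqrt (a x))^-1 * v x 0 i').
      by apply: CM => //; apply: CV => //; exact: Csqrt.
    by apply/funext => x; rewrite block_mxEdl !ord1 mxE mxE.
  + rewrite (_ : (fun=> _) = fun x => S x i' j') //.
    by apply/funext => x; rewrite block_mxEdr.
- move=> i x; case: (split_ordP i) => i' ->.
  + by have := sqrt0 x; congr (_ < _); rewrite block_mxEul ord1 mxE.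
  + by have := posS i' x; congr (_ < _); rewrite block_mxEdr.
- move=> x; rewrite AE tr_block_mx mulmx_block !trmx0 !mulmx0 !mul0mx !addr0.
  rewrite tr_scalar_mx !linearZ /= trmxK -scalar_mxM -expr2 sqr_sqrtr ?ltW//.
  rewrite mul_mx_scalar mul_scalar_mx !scalerA mulVf ?mulfV ?gt_eqF// !scale1r.
  rewrite -scalemxAl scalerA -invfM -expr2 sqr_sqrtr ?ltW// -SE.
  by rewrite addrC subrK.
Qed.

End class.
End cholesky.

(** * Borel sets and Lebesgue measure on R^d *)

Section measure_rV.
Context {R : realType}.

Lemma rV_ballE d (x y : 'rV[R]_d) e : 0 < e ->
  ball x e y <-> forall j, `|x ord0 j - y ord0 j| < e.
Proof.
move=> e0; split=> [[_ xy] j|xy]; first exact: xy.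
by split => // i j; rewrite ord1; exact: xy.
Qed.

Lemma measurable_rV_ball d (x : 'rV[R]_d) e : measurable (ball x e).
Proof.
have [e0|e0] := ltP 0 e; last first.
  rewrite (_ : ball x e = set0) //; apply/seteqP; split => // y [].
  by rewrite ltNge e0.
rewrite (_ : ball x e = \bigcap_(j in [set: 'I_d])
    (@rV_coord R d j @^-1` ball (x ord0 j) e)); last first.
  apply/seteqP; split => y; first by move/(rV_ballE _ _ e0) => xy j _; exact: xy.
  by move=> xy; apply/rV_ballE => // j; exact: xy.
apply: fin_bigcap_measurable => // j _; rewrite -[X in measurable X]setTI.
exact: (@measurable_rV_coord R d j measurableT _ (measurable_ball _ _)).
Qed.

Lemma rV_rat_dense d (x : 'rV[R]_d) (e : R) : 0 < e ->
  exists q : 'rV[rat]_d, ball (map_mx ratr q : 'rV[R]_d) e x.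
Proof.
move=> e0.
have /choice[q qE] : forall j, exists q : rat, `|ratr q - x ord0 j| < e.
  move=> j; have /rat_in_itvoo[q] : x ord0 j - e < x ord0 j + e by lra.
  by rewrite in_itv /= => /andP[? ?]; exists q; rewrite ltr_distl; apply/andP.
by exists (\row_j q j); apply/rV_ballE => // j; rewrite !mxE.
Qed.

(** The sigma-algebra is generated by coordinates, so second countability is what is used: an open
    set is a countable union of balls with rational centre and radius 1/(n+1), and each ball is a
    finite intersection of coordinate conditions. *)
Lemma measurable_open_rV d (U : set 'rV[R]_d) : open U -> measurable U.
Proof.
move=> oU.
pose B (k : 'rV[rat]_d * nat) : set 'rV[R]_d :=
  let b := ball (map_mx ratr k.1 : 'rV[R]_d) k.2.+1%:R^-1 in
  if `[< b `<=` U >] then b else set0.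
rewrite (_ : U = \bigcup_k B k).
  apply: countable_bigcupT_measurable; first exact: countableP.
  by move=> k; rewrite /B; case: asboolP => // _; exact: measurable_rV_ball.
apply/seteqP; split => [x Ux|x [k _]]; last first.
  by rewrite /B; case: asboolP => // bU /bU.
have /nbhs_ballP[e /= e0 eU] : nbhs x U by exact: open_nbhs_nbhs.
have [n ne] : exists n : nat, n.+1%:R^-1 < e / 2.
  have /ltr_add_invr[n nE] : 0 < e / 2 by rewrite divr_gt0.
  by exists n; rewrite add0r in nE.
have [q qx] := @rV_rat_dense d x n.+1%:R^-1 ltac:(by []).
exists (q, n) => //; rewrite /B /=; case: asboolP => // -[] y qy.
apply: eU; apply: (@le_ball _ _ _ (n.+1%:R^-1 + n.+1%:R^-1)).
  by rewrite (splitr e) lerD ?ltW.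
by apply: ball_triangle qy; exact: ball_sym.
Qed.

Lemma continuous_rV_measurable d (f : 'rV[R]_d -> R) :
  continuous f -> measurable_fun [set: 'rV[R]_d] f.
Proof.
move=> /continuousP cf.
apply: (measurability _ (RGenOInfty.measurableE R)) => //.
move=> _ [_ [a ->] <-]; rewrite setTI; apply: measurable_open_rV.
by apply/cf/interval_open.
Qed.

(** The image measure under a translation gives half-open intervals their length, so uniqueness of
    Lebesgue measure identifies it. *)
Lemma lebesgue_measure_shift (a : R) (A : set (measurableTypeR R)) :
  measurable A -> lebesgue_measure (shift a @^-1` A) = lebesgue_measure A.
Proof.
move=> mA.
have ms : measurable_fun [set: measurableTypeR R] (shift a : _ -> measurableTypeR R).
  exact: measurable_funD.
pose mu : {measure set (measurableTypeR R) -> \bar R} :=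
  measure_function_pushforward__canonical__measure_function_Measure
    (@lebesgue_measure R) ms.
apply/esym/(@lebesgue_measure_unique R mu) => // _ [[x y] _ <-] /=.
rewrite /pushforward (_ : _ @^-1` _ = `](x - a), (y - a)]%classic); last first.
  by apply/seteqP; split => z /=; rewrite !in_itv /= ltrBlDr lerBrDr.
rewrite !lebesgue_measure_itv /= !lte_fin ltrD2r -!EFinB (_ : y - a - (x - a) = y - x) //.
ring.
Qed.

(** Induction on the dimension: a translation acts separately on the first coordinate and on the
    others, so its image of the product measure agrees with it on rectangles, and a product measure
    is determined there. *)
Lemma lebesgue_rV_shift d (a : 'rV[R]_d) (A : set 'rV[R]_d) :
  measurable A -> lebesgue_rV R d (shift a @^-1` A) = lebesgue_rV R d A.
Proof.
elim: d a A => [|d IH] a A mA.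
  by congr (lebesgue_rV R 0 _); apply/funext => x /=; rewrite [a]thinmx0 addr0.
rewrite /= /lebesgue_rVS /pushforward.
pose a0 : R := a ord0 ord0; pose a1 : 'rV[R]_d := \row_j a ord0 (lift ord0 j).
pose s (x : measurableTypeR R * 'rV[R]_d) : measurableTypeR R * 'rV[R]_d :=
  (x.1 + a0, x.2 + a1).
have ms1 : measurable_fun [set: 'rV[R]_d] (shift a1).
  apply: measurable_fun_rVP => i.
  rewrite (_ : _ \o _ = fun x => rV_coord i x + a1 ord0 i); last first.
    by apply/funext => x; rewrite /rV_coord /= mxE.
  by apply: measurable_funD => //; exact: measurable_rV_coord.
have ms : measurable_fun setT s.
  apply: measurable_fun_pair.
    by apply: measurable_funD => //; exact: measurable_fst.
  by apply: (measurableT_comp ms1); exact: measurable_snd.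
pose mu : {measure set (measurableTypeR R * 'rV[R]_d) -> \bar R} :=
  measure_function_pushforward__canonical__measure_function_Measure
    (@lebesgue_measure R \x lebesgue_rV R d)%E ms.
rewrite (_ : _ @^-1` _ = s @^-1` (@rV_cons R d @^-1` A)); last first.
  apply/funext => -[x y]; rewrite /preimage /mkset /=; congr (A _).
  apply/rowP => i; rewrite !mxE.
  by case: (unliftP ord0 i) => [j|] -> //=; rewrite !mxE.
have mc : measurable (@rV_cons R d @^-1` A).
  by rewrite -[X in measurable X]setTI; exact: measurable_rV_cons.
apply/esym/(@product_measure_unique _ _ _ _ _ _ _ mu) => // B C mB mC.
rewrite /mu /= /pushforward.
rewrite (_ : s @^-1` _ = (shift a0 @^-1` B) `*` (shift a1 @^-1` C)) //.
rewrite product_measure1E; last 2 first.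
- rewrite -[X in measurable X]setTI; exact: measurable_funD.
- by rewrite -[X in measurable X]setTI; exact: ms1.
congr (_ * _)%E; first exact: lebesgue_measure_shift.
exact: IH.
Qed.

Lemma lebesgue_rV_ball_fin d r : (lebesgue_rV R d (ball (0%R : 'rV[R]_d) r) < +oo)%E.
Proof.
have [r0|r0] := ltP 0 r; last first.
  rewrite (_ : ball (0 : 'rV[R]_d) r = set0) ?measure0 //; apply/seteqP; split => // y [].
  by rewrite ltNge r0.
rewrite (_ : ball (0 : 'rV[R]_d) r = [set x | forall i, ball (0 : R) r (x ord0 i)]); last first.
  apply/seteqP; split => y.
    by move/(rV_ballE _ _ r0) => H i; have := H i; rewrite mxE.
  by move=> H; apply/rV_ballE => // i; rewrite mxE; exact: H.
rewrite (@lebesgue_rV_box R d (fun=> ball (0 : R) r)); last by move=> i; exact: measurable_ball.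
rewrite lebesgue_measure_ball ?ltW //.
suff /andP[] : (0 <= \prod_(i < d) (r *+ 2)%:E < +oo)%E by [].
elim/big_ind : _ => [|x y /andP[x0 xoo] /andP[y0 yoo]|i _].
- by rewrite lee_fin ler01 ltry.
- by rewrite mule_ge0 //= lte_mul_pinfty // ge0_fin_numE.
- by rewrite lee_fin mulrn_wge0 ?ltW //= ltry.
Qed.

End measure_rV.

(** * Functions supported in a ball *)

Section compact_support.
Context {R : realType} {d : nat}.
Implicit Types (f h psi : 'rV[R]_d -> R) (r : R).
Local Notation mu := (lebesgue_rV R d).

(** A quantitative form of compact support: the explicit radius records how much supports grow under
    translation, differentiation and smoothing. *)
Definition vanishes_outside r psi := forall x, r <= `|x| -> psi x = 0.

Lemma ball0_normE r (x : 'rV[R]_d) : ball 0 r x = (`|x| < r) :> Prop.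
Proof. by rewrite -ball_normE /ball_ /= sub0r normrN. Qed.

Lemma compact_norm_le r : compact [set x : 'rV[R]_d | `|x| <= r].
Proof.
apply: bounded_closed_compact.
  by exists r; split; [exact: num_real|move=> M rM x /= /le_trans; apply; exact: ltW].
apply: (@closed_comp _ _ (fun x : 'rV[R]_d => `|x|) [set y | y <= r]).
  by move=> x _; exact: norm_continuous.
exact: closed_le.
Qed.

Lemma continuous_bounded_ball f r : continuous f ->
  exists M, 0 <= M /\ forall x, `|x| <= r -> `|f x| <= M.
Proof.
move=> cf; have [r0|r0] := leP 0 r; last first.
  by exists 0; split => // x /le_lt_trans/(_ r0); rewrite ltNge normr_ge0.
have [||c _ cmax] := @EVT_max_rV R d (fun x => `|f x|) _ _ (@compact_norm_le r).
- by exists 0; rewrite /= normr0.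
- by apply: continuous_subspaceT => x; apply: continuous_comp; [exact: cf|exact: norm_continuous].
by exists `|f c|; split => // x xr; apply: cmax; rewrite inE.
Qed.

(** Only [x] is confined to the compact ball; [y] may leave it, so that points can be compared
    across the boundary. *)
Lemma continuous_unif_ball f r (e : R) : continuous f -> 0 < e ->
  exists2 del, 0 < del &
    forall x y, `|x| <= r -> `|x - y| < del -> `|f x - f y| < e.
Proof.
move=> cf e0.
have /compact_near_coveringP := @compact_norm_le r.
move=> /(_ R (nbhs (0 : R)) (fun del x => forall y, `|x - y| < del -> `|f x - f y| < e)).
case=> [x _|del /= del0 H].
  have /cvgr_dist_lt/(_ (e / 2)) := cf x.
  rewrite divr_gt0 // => /(_ isT)/nbhs_ballP[t /= t0 tH].
  exists (ball x (t / 2), ball 0 (t / 2)).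
    by split; apply: nbhsx_ballx; rewrite divr_gt0.
  move=> [y del] /= [xy del0] z yz.
  have fxy : `|f x - f y| < e / 2.
    by apply: tH; apply: le_ball xy; rewrite ler_pdivrMr // ler_pMr // ler1n.
  have fxz : `|f x - f z| < e / 2.
    apply: tH; rewrite (splitr t); apply: ball_triangle xy _.
    rewrite -ball_normE /=; apply: lt_le_trans yz _.
    by move: del0; rewrite -ball_normE /= sub0r normrN => /ltW; apply: le_trans; exact: ler_norm.
  rewrite (splitr e) (_ : _ - _ = (f x - f z) - (f x - f y)); last by ring.
  by rewrite (le_lt_trans (ler_normB _ _)) // ltrD.
(* The covering property holds for all parameters in the open ball of radius [del] around 0, and
   half of [del] is one of them. *)
exists (del / 2); first by rewrite divr_gt0.
move=> x y xr; apply: H => //.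
by rewrite /= sub0r normrN gtr0_norm ?divr_gt0 // ltr_pdivrMr // ltr_pMr // ltr1n.
Qed.

Lemma vanishes_outside_bounded psi r : continuous psi -> vanishes_outside r psi ->
  exists M, 0 <= M /\ forall x, `|psi x| <= M.
Proof.
move=> /(@continuous_bounded_ball _ r)[M [M0 psiM]] psi0; exists M; split => // x.
by have [/psiM//|/ltW /psi0 ->] := leP `|x| r; rewrite normr0.
Qed.

Lemma continuous_locally_integrable f r : continuous f ->
  mu.-integrable (ball 0 r) (EFin \o f).
Proof.
move=> cf; apply: measurable_bounded_integrable.
- exact: measurable_rV_ball.
- exact: lebesgue_rV_ball_fin.
- by apply: measurable_funTS; exact: continuous_rV_measurable.
have [M [M0 fM]] := continuous_bounded_ball r cf.
exists M; split; first exact: num_real.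
move=> N MN x /=; rewrite ball0_normE => xr.
by rewrite (le_trans (fM _ (ltW xr))) ?ltW.
Qed.

Lemma vanishes_outside_integrable psi r :
  continuous psi -> vanishes_outside r psi -> mu.-integrable setT (EFin \o psi).
Proof.
move=> cpsi psi0.
rewrite (_ : EFin \o psi = (EFin \o psi) \_ (ball 0 r)); last first.
  apply/funext => x; rewrite patchE; case: ifPn => // /negP; rewrite inE ball0_normE.
  by move/negP; rewrite -leNgt => /psi0 /= ->.
by apply/(integrable_mkcond _ (measurable_rV_ball _ _)); exact: continuous_locally_integrable.
Qed.

Lemma bounded_mul_integrable psi g M : continuous psi -> (forall x, `|psi x| <= M) ->
  mu.-integrable setT (EFin \o g) ->
  mu.-integrable setT (EFin \o (fun x => psi x * g x)).
Proof.
move=> cpsi psiM ig; apply: (integrableMr _ _ _ ig) => //.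
  exact: continuous_rV_measurable.
exists M; split; first exact: num_real.
by move=> N MN x _; apply: le_trans (psiM x) _; exact: ltW.
Qed.

Lemma Rintegral_shift h a : measurable_fun setT h ->
  mu.-integrable setT (EFin \o (fun x => h (x + a))) ->
  \int[mu]_x h (x + a) = \int[mu]_x h x.
Proof.
move=> mh ih; congr fine.
have ms : measurable_fun [set: 'rV[R]_d] (shift a).
  apply: measurable_fun_rVP => i.
  rewrite (_ : _ \o _ = fun x => rV_coord i x + a ord0 i); last first.
    by apply/funext => x; rewrite /rV_coord /= mxE.
  by apply: measurable_funD => //; exact: measurable_rV_coord.
rewrite -[LHS](@integral_pushforward _ _ _ _ _ _ ms mu setT (EFin \o h)) //.
  by apply: eq_measure_integral => A mA _; exact: lebesgue_rV_shift.
exact/measurable_EFinP.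
Qed.

End compact_support.

(** * Smooth functions *)

Section Ck_algebra.
Context {R : realType} {d : nat}.
Implicit Types (f g : 'rV[R]_d -> R) (k : nat).

Lemma CkW k f : Ck k.+1 f -> Ck k f.
Proof.
elim: k f => [|k IH] f [cf fk]; first by split.
by split => // i; have [df /IH] := fk i.
Qed.

Lemma Ck_cst k (c : R) : Ck k (fun _ : 'rV[R]_d => c).
Proof.
elim: k c => [|k IH] c; first by split => // x; exact: cst_continuous.
split; first by move=> x; exact: cst_continuous.
move=> i; split; first by move=> x; exact: derivable_cst.
rewrite (_ : partial i _ = fun=> 0) //.
by apply/funext => x; exact: derive_cst.
Qed.

Lemma CkD k f g : Ck k f -> Ck k g -> Ck k (f + g).
Proof.
elim: k f g => [|k IH] f g [cf fk] [cg gk].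
  by split => // x; exact: (continuousD (cf x) (cg x)).
split => [x|i]; first by apply: (continuousD (cf x) (cg x)).
have [[df fki] [dg gki]] := (fk i, gk i).
split => [x|]; first exact: derivableD.
rewrite (_ : partial i _ = partial i f + partial i g); first exact: IH.
by apply/funext => x; exact: deriveD.
Qed.

Lemma CkM k f g : Ck k f -> Ck k g -> Ck k (f * g).
Proof.
elim: k f g => [|k IH] f g Ckf Ckg; have [[cf fk] [cg gk]] := (Ckf, Ckg).
  by split => // x; exact: (continuousM (cf x) (cg x)).
split => [x|i]; first exact: (continuousM (cf x) (cg x)).
have [[df fki] [dg gki]] := (fk i, gk i).
split => [x|]; first exact: derivableM.
rewrite (_ : partial i _ = f * partial i g + g * partial i f).
  by apply: CkD; apply: IH => //; exact: CkW.
by apply/funext => x; exact: deriveM.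
Qed.

(** The partial derivatives of 1/f are - f^-2 times those of f, hence built from functions already
    known to be of class C^k by induction. *)
Lemma CkV k f : (forall x, f x != 0) -> Ck k f -> Ck k (fun x => (f x)^-1).
Proof.
move=> f0; elim: k => [|k IH] Ckf.
  by have [cf _] := Ckf; split => // x; apply: continuousV => //; exact: cf.
have [cf fk] := Ckf.
split => [x|i]; first by apply: continuousV => //; exact: cf.
have [df fki] := fk i.
split => [x|]; first exact: derivableV.
have CkfV := IH (CkW Ckf).
rewrite (_ : partial i _ =
    (fun=> -1) * ((fun x => (f x)^-1) * (fun x => (f x)^-1)) * partial i f).
  by apply: CkM => //; apply: CkM; [exact: Ck_cst|exact: CkM].
apply/funext => x; rewrite [LHS]deriveV //.
change (- (f x) ^- 2 * partial i f x = -1 * ((f x)^-1 * (f x)^-1) * partial i f x).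
by rewrite expr2 invfM mulN1r.
Qed.

Lemma smooth_sum (I : Type) (s : seq I) (F : I -> 'rV[R]_d -> R) :
  (forall i, smooth (F i)) -> smooth (fun x => \sum_(i <- s) F i x).
Proof.
move=> sF k; elim: s => [|i s IH].
  by under eq_fun do rewrite big_nil; exact: Ck_cst.
by under eq_fun do rewrite big_cons; apply: CkD => //; exact: sF.
Qed.

Lemma smooth_prod (I : Type) (s : seq I) (F : I -> 'rV[R]_d -> R) :
  (forall i, smooth (F i)) -> smooth (fun x => \prod_(i <- s) F i x).
Proof.
move=> sF k; elim: s => [|i s IH].
  by under eq_fun do rewrite big_nil; exact: Ck_cst.
by under eq_fun do rewrite big_cons; apply: CkM => //; exact: sF.
Qed.

Lemma is_derive_line f x v df :
  is_derive (0 : R) 1 (fun h => f (h *: v + x)) df -> is_derive x v f df.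
Proof.
move=> [dl <-].
suff E : (fun h => h^-1 *: (((fun h => f (h *: v + x)) \o shift 0) (h *: 1) - f (0 *: v + x))) =
    (fun h => h^-1 *: ((f \o shift x) (h *: v) - f x)).
  by apply: DeriveDef; [rewrite /derivable -E|rewrite /derive E].
apply/funext => h /=; rewrite scale0r add0r addr0.
by rewrite [_%:A]mulr1.
Qed.

Lemma line_is_derive f x v df (t : R) :
  is_derive (t *: v + x) v f df -> is_derive t 1 (fun h => f (h *: v + x)) df.
Proof.
move=> [dl <-].
suff E : (fun h => h^-1 *: (((fun h => f (h *: v + x)) \o shift t) (h *: 1) - f (t *: v + x))) =
    (fun h => h^-1 *: ((f \o shift (t *: v + x)) (h *: v) - f (t *: v + x))).
  by apply: DeriveDef; rewrite /derivable /derive E.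
apply/funext => h /=; congr (_ *: (f _ - _)).
by rewrite [_%:A]mulr1 scalerDl addrA.
Qed.

(** [E] is a family of functions closed under differentiation, [D] giving the index of the
    derivative. Induction on the order, for all indices at once, then makes every member smooth
    without formulas for higher derivatives. *)
Lemma smooth_affine_comp (T : Type) (E : T -> R -> R) (D : T -> T) :
  (forall t (y : R), is_derive y (1 : R) (E t) (E (D t) y)) ->
  forall t (a b : R) (j : 'I_d), smooth (fun x => E t (a * x ord0 j + b)).
Proof.
move=> ED t a b j k.
have der t' (x : 'rV[R]_d) i : is_derive x (delta_mx ord0 i)
    (fun x : 'rV[R]_d => E t' (a * x ord0 j + b))
    ((a * (j == i)%:R) * E (D t') (a * x ord0 j + b)).
  apply: is_derive_line.
  have -> : (fun h : R => E t' (a * (h *: delta_mx ord0 i + x) ord0 j + b)) =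
      E t' \o (fun h => h * (a * (j == i)%:R) + (a * x ord0 j + b)).
    by apply/funext => h /=; rewrite !mxE eqxx /=; congr (E t' _); ring.
  set c := a * _; set y0 := a * x ord0 j + b.
  have d1 : is_derive (0 : R) 1 (fun h : R => h * c + y0) c.
    apply: is_derive_eq; rewrite /= ?scaler0 ?scale0r ?addr0 ?add0r ?[_%:A]mulr1 //.
  have d2 := ED t' (0 * c + y0).
  have := @is_derive1_comp R (E t') (fun h => h * c + y0) 0 _ _ d2 d1.
  by rewrite mul0r add0r mulrC.
have cont t' : continuous (fun x : 'rV[R]_d => E t' (a * x ord0 j + b)).
  move=> x; apply: (@continuous_comp _ _ _ (fun x : 'rV[R]_d => a * x ord0 j + b) (E t')).
    apply: (@continuousD _ _ _ (fun x : 'rV[R]_d => a * x ord0 j) (cst b));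
      last exact: cst_continuous.
    apply: (@continuousM _ _ (cst a) (fun x : 'rV[R]_d => x ord0 j)); first exact: cst_continuous.
    exact: coord_continuous.
  by apply/differentiable_continuous/derivable1_diffP; have [] := ED t' (a * x ord0 j + b).
elim: k t => [|k IH] t; first by split.
split => // i; split => [x|]; first by have [] := der t x i.
rewrite (_ : partial i _ = (fun=> a * (j == i)%:R) * (fun x => E (D t) (a * x ord0 j + b))).
  by apply: CkM => //; exact: Ck_cst.
by apply/funext => x; rewrite /partial (@derive_val _ _ _ _ _ _ _ (der t x i)).
Qed.

End Ck_algebra.

(** * A smooth transition from 0 to 1 *)

Section smooth_step.
Context {R : realType}.
Implicit Types (P : {poly R}) (y : R).

(* A family containing exp(-1/y) and closed under differentiation. *)
Definition flat P y : R := if 0 < y then P.[y^-1] * expR (- y^-1) else 0.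

Lemma horner_expR_bound P : exists2 C, 0 <= C &
  forall u : R, 0 <= u -> `|P.[u]| <= C * expR u.
Proof.
(* Each monomial satisfies u^i <= i! exp u, by the exponential series. *)
exists (\sum_(i < size P) `|P`_i| * i`!%:R).
  by apply: sumr_ge0 => i _; rewrite mulr_ge0.
move=> u u0; rewrite horner_coef mulr_suml.
apply: le_trans (ler_norm_sum _ _ _) _; apply: ler_sum => i _.
rewrite normrM -mulrA ler_wpM2l // normrX ger0_norm //.
case: (nat_of_ord i) => [|n]; first by rewrite expr0 fact0 mul1r -expR0 ler_expR.
rewrite mulrC -ler_pdivrMr ?ltr0n ?fact_gt0 //.
by apply: le_trans (expR_ge1Dxn n u0); rewrite lerDr.
Qed.

(** The exponential bound for the polynomial P X^2 at u = 1/y gains the factor y^2. This quadratic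
    decay yields the zero derivative at the origin. *)
Lemma flat_quadratic P : exists2 C, 0 <= C & forall y, `|flat P y| <= C * y ^+ 2.
Proof.
have [C C0 PC] := horner_expR_bound (P * 'X^2).
exists C => // y; rewrite /flat; case: ifPn => [y0|_]; last first.
  by rewrite normr0 mulr_ge0 // sqr_ge0.
have := PC y^-1; rewrite invr_ge0 ltW // => /(_ isT).
rewrite hornerM hornerXn normrM [`|_ ^+ 2|]ger0_norm ?sqr_ge0 //.
rewrite exprVn ler_pdivrMr ?exprn_gt0 // => H.
by rewrite normrM (ger0_norm (expR_ge0 _)) expRN ler_pdivrMr ?expR_gt0 // mulrAC.
Qed.

(** For y > 0 the product and chain rules give (P - P')(1/y) y^-2 exp(-1/y); for y < 0 the function
    is locally 0; at 0 the difference quotient is bounded by a multiple of |h|. *)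
Lemma is_derive_flat P y : is_derive y (1 : R) (flat P) (flat ('X^2 * (P - P^`())) y).
Proof.
have [y0|y0|->] := ltgtP y 0.
- apply: (@near_eq_is_derive _ _ _ (cst 0)).
    near=> z; rewrite /flat ltNge (_ : z <= 0) //=.
    by apply: ltW; near: z; exact: lt_nbhsl.
  by rewrite {1}/flat ltNge ltW //=; exact: is_derive_cst.
- apply: (@near_eq_is_derive _ _ _ (fun z : R => P.[z^-1] * expR (- z^-1))).
    near=> z; rewrite /flat (_ : 0 < z) //.
    by near: z; exact: lt_nbhsr.
  have y1 : y != 0 by rewrite gt_eqF.
  have dV : is_derive y (1 : R) (fun z : R => z^-1) (- y ^- 2).
    by have := is_deriveV y1 (is_derive_id y (1 : R)); rewrite /GRing.scale /= mulr1.
  have dVN : is_derive y (1 : R) (fun z : R => - z^-1) (y ^- 2).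
    by have := is_deriveN dV; rewrite opprK.
  have d1 := @is_derive1_comp R (horner P) (fun z : R => z^-1) y _ _ (is_derive_poly P y^-1) dV.
  have d2 := @is_derive1_comp R expR (fun z : R => - z^-1) y _ _ (is_derive_expR (- y^-1)) dVN.
  apply: is_derive_eq (is_deriveM d1 d2) _.
  rewrite /flat y0 !hornerE /GRing.scale /= exprVn; ring.
- have -> : flat ('X^2 * (P - P^`())) 0 = 0 by rewrite /flat ltxx.
  suff cv : h^-1 *: ((flat P \o shift 0) (h *: 1) - flat P 0) @[h --> 0^'] --> (0 : R).
    by apply: DeriveDef; [apply/cvg_ex; exists 0|exact: cvg_lim].
  have [C C0 PC] := flat_quadratic P.
  have C1 : 0 < C + 1 by rewrite ltr_wpDl.
  apply/cvgr0Pnorm_le => e e0; have eC : 0 < e / (C + 1) by rewrite divr_gt0.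
  near=> h.
  have h0 : h != 0 by near: h; exact: nbhs_dnbhs_neq.
  rewrite [flat P 0]/flat ltxx subr0 /= addr0 [_%:A]mulr1 normrZ normfV.
  rewrite ler_pdivrMl ?normr_gt0 //; apply: le_trans (PC h) _.
  rewrite -real_normK ?num_real // expr2 mulrA [leRHS]mulrC ler_wpM2r //.
  apply: (@le_trans _ _ ((C + 1) * `|h|)); first by rewrite ler_wpM2r // lerDl.
  rewrite mulrC -ler_pdivlMr //; apply/ltW; near: h.
  exact: dnbhs0_lt.
Unshelve. all: by end_near. Qed.

Definition smooth_step y : R := flat 1 y / (flat 1 y + flat 1 (1 - y)).

Lemma flat1_ge0 y : 0 <= flat 1 y.
Proof. by rewrite /flat; case: ifP => // _; rewrite hornerC mul1r expR_ge0. Qed.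

Lemma flat1_gt0 y : 0 < y -> 0 < flat 1 y.
Proof. by rewrite /flat => ->; rewrite hornerC mul1r expR_gt0. Qed.

Lemma smooth_step_den y : 0 < flat 1 y + flat 1 (1 - y).
Proof.
have [y0|y0] := ltP 0 y.
  by rewrite ltr_pwDl ?flat1_gt0 ?flat1_ge0.
by rewrite ltr_wpDl ?flat1_ge0 // flat1_gt0 // subr_gt0 (le_lt_trans y0).
Qed.

Lemma smooth_step_le0 y : y <= 0 -> smooth_step y = 0.
Proof. by rewrite leNgt /smooth_step {1}/flat => /negPf ->; rewrite mul0r. Qed.

Lemma smooth_step_ge1 y : 1 <= y -> smooth_step y = 1.
Proof.
move=> y1; rewrite /smooth_step {3}/flat subr_gt0 ltNge y1 addr0 divff //.
by rewrite gt_eqF // flat1_gt0 // (lt_le_trans _ y1).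
Qed.

Lemma smooth_step_ge0 y : 0 <= smooth_step y.
Proof. by rewrite divr_ge0 ?flat1_ge0 // ltW // smooth_step_den. Qed.

Lemma smooth_step_le1 y : smooth_step y <= 1.
Proof. by rewrite ler_pdivrMr ?smooth_step_den // mul1r lerDl flat1_ge0. Qed.

(** With y affine in a coordinate, 1 - y is affine too, so numerator and denominator both come from
    [flat], and the denominator never vanishes. *)
Lemma smooth_smooth_step d (a b : R) (j : 'I_d) :
  smooth (fun x : 'rV[R]_d => smooth_step (a * x ord0 j + b)).
Proof.
move=> k; have s := smooth_affine_comp is_derive_flat 1.
rewrite (_ : (fun _ => _) = (fun x : 'rV[R]_d => flat 1 (a * x ord0 j + b)) *
  (fun x => (flat 1 (a * x ord0 j + b) + flat 1 (- a * x ord0 j + (1 - b)))^-1)).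
  apply: CkM; first exact: s.
  apply: CkV; last by apply: CkD; exact: s.
  move=> x; rewrite gt_eqF // (_ : _ + (1 - b) = 1 - (a * x ord0 j + b)); last by ring.
  exact: smooth_step_den.
apply/funext => x; rewrite /smooth_step (_ : 1 - _ = - a * x ord0 j + (1 - b)) //; ring.
Qed.

End smooth_step.

(** * Uniform approximation by test functions *)

Section smooth_approximation.
Context {R : realType} {d : nat}.
Implicit Types (x : 'rV[R]_d).

Lemma rV_coord_le_norm x j : `|x ord0 j| <= `|x|.
Proof. by rewrite [leRHS]/Num.norm /= mx_normrE; apply/bigmax_geP; right; exists (ord0, j). Qed.

Lemma rV_norm_ltP x (e : R) : 0 < e -> (forall j, `|x ord0 j| < e) -> `|x| < e.
Proof.
move=> e0 xe; rewrite -ball0_normE; apply/rV_ballE => // j.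
by rewrite mxE sub0r normrN.
Qed.

(* The integer translates of [hat] add up to 1, as their sum telescopes. *)
Definition hat (y : R) := smooth_step (y + 1) - smooth_step y.

Lemma hat_ge0 y : 0 <= hat y.
Proof.
rewrite subr_ge0; have [y0|y0] := leP y 0.
  by rewrite (smooth_step_le0 y0) smooth_step_ge0.
by rewrite (@smooth_step_ge1 _ (y + 1)) ?smooth_step_le1 // lerDr ltW.
Qed.

Lemma hat_eq0 y : 1 <= `|y| -> hat y = 0.
Proof.
rewrite /hat ler_normr => /orP[y1|y1].
  by rewrite !smooth_step_ge1 ?subrr // ler_wpDr.
by rewrite !smooth_step_le0 ?subrr //; lra.
Qed.

Lemma sum_hat (y : R) (K : nat) : `|y| <= K%:R ->
  \sum_(k < K.*2.+1) hat (y - (k%:R - K%:R)) = 1.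
Proof.
rewrite ler_norml => /andP[Ky yK].
rewrite -(big_mkord xpredT (fun k => hat (y - (k%:R - K%:R)))).
(* The sum telescopes to the step at y + K + 1 >= 1 minus the step at y - K <= 0, that is, to 1 -
   0. *)
rewrite (eq_bigr (fun k => - smooth_step (y + K%:R + 1 - k.+1%:R) -
    - smooth_step (y + K%:R + 1 - k%:R))).
  rewrite telescope_sumr // opprK (@smooth_step_le0 _ (_ - K.*2.+1%:R)); last first.
    by rewrite -addn1 -addnn !natrD; lra.
  by rewrite subr0 smooth_step_ge1 ?oppr0 ?add0r //; lra.
move=> k _; rewrite /hat opprK addrC; congr (- smooth_step _ + smooth_step _).
  by rewrite -addn1 natrD; lra.
by lra.
Qed.

Lemma smooth_hat (a b : R) (j : 'I_d) :
  smooth (fun x : 'rV[R]_d => hat (a * x ord0 j + b)).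
Proof.
move=> k; rewrite (_ : (fun _ => _) =
  (fun x : 'rV[R]_d => smooth_step (a * x ord0 j + (b + 1))) +
  (fun=> -1) * (fun x : 'rV[R]_d => smooth_step (a * x ord0 j + b))).
  apply: CkD; first exact: smooth_smooth_step.
  by apply: CkM; [exact: Ck_cst|exact: smooth_smooth_step].
apply/funext => x; change (hat (a * x ord0 j + b) =
  smooth_step (a * x ord0 j + (b + 1)) + -1 * smooth_step (a * x ord0 j + b)).
by rewrite /hat mulN1r addrA.
Qed.

(** Products of scaled [hat] functions form a smooth partition of unity attached to a grid of mesh
    1/N. The approximant weights the values of [psi] at the grid points, so near the support it is a
    convex combination of values taken within 1/N of x. *)
Lemma smooth_approx (psi : 'rV[R]_d -> R) (r e : R) :
  continuous psi -> vanishes_outside r psi -> 0 < e ->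
  exists phi : 'rV[R]_d -> R,
    [/\ smooth phi, vanishes_outside (r + 1) phi &
        forall x, `|phi x - psi x| <= e].
Proof.
move=> cpsi psi0 e0.
have [del del0 psi_unif] := continuous_unif_ball (r + 1) cpsi e0.
(* Mesh below [del] gives the error bound by uniform continuity; mesh below 1 keeps the support
   within radius r + 1. *)
have [N0 N0d] : exists n : nat, n.+1%:R^-1 < Num.min del 1.
  have : 0 < Num.min del 1 by rewrite lt_min del0 ltr01.
  by move=> /ltr_add_invr[n]; rewrite add0r => ?; exists n.
move: N0d; rewrite lt_min => /andP[Ndel N1].
pose N : R := N0.+1%:R; have N_gt0 : 0 < N by rewrite ltr0n.
(* The grid coordinates range over (k - K)/N for k = 0, ..., 2K and so cover the ball of radius r +
   1. *)
have [K KP] : exists K : nat, N * (r + 1) <= K%:R.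
  exists (Num.bound `|N * (r + 1)|); apply/ltW.
  exact: le_lt_trans (ler_norm _) (archi_boundP (normr_ge0 _)).
pose g (k : {ffun 'I_d -> 'I_K.*2.+1}) : 'rV[R]_d := \row_j (((k j)%:R - K%:R) / N).
pose w (k : {ffun 'I_d -> 'I_K.*2.+1}) x := \prod_j hat (N * x ord0 j - ((k j)%:R - K%:R)).
have w_ge0 k x : 0 <= w k x by apply: prodr_ge0 => j _; exact: hat_ge0.
have w_supp k x : w k x != 0 -> `|x - g k| < N^-1.
  move/prodf_neq0 => wk; apply: rV_norm_ltP; first by rewrite invr_gt0.
  move=> j; have := wk j isT; apply: contra_neqT; rewrite -leNgt => xg.
  apply: hat_eq0; move: xg; rewrite !mxE => xg.
  rewrite (_ : N * _ - _ = N * (x ord0 j - ((k j)%:R - K%:R) / N)).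
    by rewrite normrM gtr0_norm // -ler_pdivrMl // mulr1.
  by rewrite mulrBr mulrCA divff ?mulr1 // gt_eqF.
have sum_w x : `|x| < r + 1 -> \sum_k w k x = 1.
  move=> xr; rewrite /w -(bigA_distr_bigA (fun j (l : 'I_K.*2.+1) =>
    hat (N * x ord0 j - (l%:R - K%:R)))).
  rewrite big1 // => j _; apply: sum_hat.
  rewrite normrM gtr0_norm //; apply: le_trans KP; rewrite ler_wpM2l // ?ltW //.
  exact: le_lt_trans (rV_coord_le_norm x j) xr.
pose phi x := \sum_k psi (g k) * w k x.
have phi0 : vanishes_outside (r + 1) phi.
  move=> x xr; rewrite /phi big1 // => k _.
  have [->|/w_supp xg] := eqVneq (w k x) 0; first by rewrite mulr0.
  (* A grid point closer than 1 to a point of norm at least r + 1 has norm at least r, where [psi]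
     vanishes. *)
  rewrite psi0 ?mul0r //; have := ler_normD (x - g k) (g k); rewrite subrK.
  have N1' : N^-1 < 1 := N1; move: xr xg N1'; clear.
  move: (`|x|) (`|g k|) (`|x - g k|) (N^-1) => *; lra.
exists phi; split => //.
- apply: smooth_sum => k l.
  apply: (@CkM _ _ _ (fun=> psi (g k))); first exact: Ck_cst.
  by apply: smooth_prod => j; exact: smooth_hat.
- move=> x; have [xr|xr] := leP (r + 1) `|x|.
    have xr' : r <= `|x| by apply: le_trans xr; rewrite lerDl.
    by rewrite phi0 // psi0 // subrr normr0 ltW.
  (* Both [psi x] and, below, [e] are spread over the weights, so that the estimate can be made term
     by term. *)
  rewrite -[psi x]mulr1 -(sum_w x xr) mulr_sumr -sumrB.
  apply: le_trans (ler_norm_sum _ _ _) _.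
  rewrite -[e]mulr1 -(sum_w x xr) mulr_sumr; apply: ler_sum => k _.
  rewrite -mulrBl normrM (ger0_norm (w_ge0 k x)).
  have [->|/w_supp xg] := eqVneq (w k x) 0; first by rewrite !mulr0.
  rewrite ler_wpM2r // distrC ltW // psi_unif // ?ltW //.
  exact: lt_trans Ndel.
Qed.

End smooth_approximation.

(** * Difference quotients *)

Section translation.
Context {R : realType} {d : nat}.
Implicit Types (f phi psi q : 'rV[R]_d -> R) (i : 'I_d) (r s t h : R).
Local Notation mu := (lebesgue_rV R d).
Local Notation "''e_' i" := (delta_mx ord0 i : 'rV[R]_d) (at level 8, i at level 2).

Lemma norm_shift_le i t (x : 'rV[R]_d) : `|t *: 'e_i + x| <= `|t| + `|x|.
Proof.
apply: le_trans (ler_normD _ _) _; rewrite lerD2r normrZ ler_piMr //.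
rewrite [leLHS]/Num.norm /= mx_normrE; apply/bigmax_leP; split => // -[a b] _ /=.
by rewrite mxE; case: (_ && _); rewrite ?normr1 ?normr0.
Qed.

Lemma norm_shift_ge i t (x : 'rV[R]_d) : `|x| - `|t| <= `|t *: 'e_i + x|.
Proof.
have := norm_shift_le i (- t) (t *: 'e_i + x).
by rewrite scaleNr addKr normrN lerBlDl.
Qed.

Lemma continuous_translate f i t : continuous f -> continuous (fun x => f (t *: 'e_i + x)).
Proof.
move=> cf x; apply: (@continuous_comp _ _ _ (fun x : 'rV[R]_d => t *: 'e_i + x) f); last exact: cf.
apply: (@continuousD _ _ _ (cst (t *: 'e_i)) id x); first exact: cst_continuous.
by move=> ?.
Qed.

Lemma vanishes_outside_shift psi i r t : vanishes_outside r psi ->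
  vanishes_outside (r + `|t|) (fun x => psi (t *: 'e_i + x)).
Proof.
move=> psi0 x xr; apply: psi0; apply: le_trans (norm_shift_ge i t x).
by rewrite lerBrDr.
Qed.

Lemma vanishes_outsideW psi r s : r <= s -> vanishes_outside r psi -> vanishes_outside s psi.
Proof. by move=> rs psi0 x /(le_trans rs)/psi0. Qed.

Lemma vanishes_outsideMl psi q r : vanishes_outside r psi ->
  vanishes_outside r (fun x => psi x * q x).
Proof. by move=> psi0 x /psi0 ->; rewrite mul0r. Qed.

(** The strict inequality ensures that [phi] vanishes in a whole neighbourhood of each point of norm
    at least [s]. *)
Lemma vanishes_outside_partial phi i r s : r < s -> vanishes_outside r phi ->
  vanishes_outside s (partial i phi).
Proof.
move=> rs phi0 x xs.
rewrite /partial (_ : 0 = 'D_'e_i (cst (0 : R)) x); last by rewrite derive_cst.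
apply: near_eq_derive.
have : (fun x : 'rV[R]_d => `|x|) y @[y --> x] --> `|x| by exact: norm_continuous.
move=> /cvgr_gt/(_ r (lt_le_trans rs xs)); apply: filterS => y /ltW.
exact: phi0.
Qed.

Lemma growth_rate_translate phi (a v x : 'rV[R]_d) :
  (fun h : R => h^-1 *: (((fun x => phi (a + x)) \o shift x) (h *: v) - phi (a + x))) =
  (fun h : R => h^-1 *: ((phi \o shift (a + x)) (h *: v) - phi (a + x))).
Proof. by apply/funext => h /=; rewrite addrCA. Qed.

Lemma partial_translate i phi (a x : 'rV[R]_d) :
  partial i (fun x => phi (a + x)) x = partial i phi (a + x).
Proof. by rewrite /partial /derive growth_rate_translate. Qed.

Lemma Ck_translate k phi i t : Ck k phi -> Ck k (fun x => phi (t *: 'e_i + x)).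
Proof.
elim: k phi => [|k IH] phi [cphi phik].
  by split => //; exact: continuous_translate.
split; first exact: continuous_translate.
move=> j; have [dphi phikj] := phik j.
split; first by move=> x; rewrite /derivable growth_rate_translate; exact: dphi.
rewrite (_ : partial j _ = fun x => partial j phi (t *: 'e_i + x)); first exact: IH.
by apply/funext => x; exact: partial_translate.
Qed.

Lemma integrable_mul_continuous psi q r :
  continuous psi -> vanishes_outside r psi -> continuous q ->
  mu.-integrable setT (EFin \o (fun x => psi x * q x)).
Proof.
move=> cpsi psi0 cq; apply: (@vanishes_outside_integrable _ _ _ r).
  by move=> x; exact: (continuousM (cpsi x) (cq x)).
exact: vanishes_outsideMl.
Qed.

(** Discrete integration by parts: translation invariance moves the shift from one factor to the
    other and reverses its sign. *)
Lemma Rintegral_difference psi q i r h :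
  continuous psi -> vanishes_outside r psi -> continuous q ->
  \int[mu]_x (psi (h *: 'e_i + x) * q x) - \int[mu]_x (psi x * q x) =
  \int[mu]_x (psi x * (q ((- h) *: 'e_i + x) - q x)).
Proof.
move=> cpsi psi0 cq; under [RHS]eq_Rintegral do rewrite mulrBr.
have cqh : continuous (fun x => q ((- h) *: 'e_i + x)) by exact: continuous_translate.
rewrite [RHS]RintegralB //; try exact: (integrable_mul_continuous cpsi psi0).
congr (_ - _).
rewrite -(Rintegral_shift (a := h *: 'e_i) (h := fun x => psi x * q ((- h) *: 'e_i + x))).
- by apply: eq_Rintegral => x _; rewrite scaleNr addrCA addNr addr0 [x + _]addrC.
- by apply: continuous_rV_measurable => x; exact: (continuousM (cpsi x) (cqh x)).
- have := integrable_mul_continuous (@continuous_translate psi i h cpsi)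
    (@vanishes_outside_shift psi i r h psi0) cq.
  congr (mu.-integrable _ _); apply/funext => x /=.
  by rewrite scaleNr addrCA addNr addr0 [x + _]addrC.
Qed.

(** Differentiation under the integral sign, with all integrands near [t] dominated by a constant on
    one fixed ball. *)
Lemma is_derive_Rintegral_shift phi q i r t :
  Ck 1 phi -> vanishes_outside r phi -> continuous q ->
  is_derive t (1 : R) (fun t => \int[mu]_x (phi (t *: 'e_i + x) * q x))
    (\int[mu]_x (partial i phi (t *: 'e_i + x) * q x)).
Proof.
move=> [cphi phi1] phi0 cq; have [dphi [cdphi _]] := phi1 i.
have dphi0 : vanishes_outside (r + 1) (partial i phi).
  by apply: vanishes_outside_partial phi0; rewrite ltrDl.
have [M [M0 dphiM]] := vanishes_outside_bounded cdphi dphi0.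
(* The derivative of [phi] is supported in radius r + 1, and shifts by parameters in (t - 1, t + 1)
   enlarge this by less than |t| + 1. *)
pose s := r + 1 + (`|t| + 1).
have [N [N0 qN]] := @continuous_bounded_ball _ _ q s cq.
have der x y : is_derive x (1 : R) (fun x => phi (x *: 'e_i + y) * q y)
    (partial i phi (x *: 'e_i + y) * q y).
  have d1 : is_derive x (1 : R) (fun x => phi (x *: 'e_i + y)) (partial i phi (x *: 'e_i + y)).
    by apply: line_is_derive; exact: derivableP.
  apply: is_derive_eq (is_deriveM d1 (is_derive_cst (q y) x (1 : R))) _.
  by rewrite scaler0 add0r /GRing.scale /= mulrC.
have d1E x y : partial1of2 (fun x y => phi (x *: 'e_i + y) * q y) x y =
    partial i phi (x *: 'e_i + y) * q y.
  by rewrite partial1of2E; exact: (@derive_val _ _ _ _ _ _ _ (der x y)).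
have tI : `]t - 1, t + 1[%classic t by rewrite /= in_itv /= ltrBlDr ltrDl ltr01.
pose G := (cst (M * N) : 'rV[R]_d -> R) \_ (ball 0 s).
have G0 y : 0 <= G y by rewrite /G patchE; case: ifP => // _; exact: mulr_ge0.
have intG : mu.-integrable setT (EFin \o G).
  rewrite /G -restrict_EFin; apply/(integrable_mkcond _ (measurable_rV_ball _ _)).
  by apply: continuous_locally_integrable; exact: cst_continuous.
have intf x : `]t - 1, t + 1[%classic x ->
    mu.-integrable setT (EFin \o (fun y => phi (x *: 'e_i + y) * q y)).
  move=> _; exact: (integrable_mul_continuous (@continuous_translate phi i x cphi)
    (@vanishes_outside_shift phi i r x phi0) cq).
have bound x y : `]t - 1, t + 1[%classic x -> [set: 'rV[R]_d] y ->
    `|partial1of2 (fun x y => phi (x *: 'e_i + y) * q y) x y| <= G y.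
  rewrite /= in_itv /= => /andP[x1 x2] _; rewrite d1E /G patchE.
  case: ifPn => [|/negP]; rewrite inE ball0_normE.
    by move=> ys; rewrite normrM ler_pM // qN // ltW.
  move/negP; rewrite -leNgt => sy; rewrite dphi0 ?mul0r ?normr0 //.
  apply: le_trans (norm_shift_ge i x y); rewrite lerBrDr; apply: le_trans sy.
  rewrite lerD2l; have := ler_normB x (x - t).
  rewrite opprB addrC subrK => _; apply: (@le_trans _ _ (`|t| + `|x - t|)).
    by have := ler_normD t (x - t); rewrite addrC subrK.
  by rewrite lerD2l ltW // ltr_distl; lra.
have := @cvg_differentiation_under_integral R _ _ mu (fun x y => phi (x *: 'e_i + y) * q y)
  setT measurableT t (t - 1) (t + 1) tI intf
  (fun x y _ _ => @ex_derive _ _ _ _ _ _ _ (der x y)) G G0 intG bound.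
have -> : \int[mu]_y partial1of2 (fun x y => phi (x *: 'e_i + y) * q y) t y =
    \int[mu]_y (partial i phi (t *: 'e_i + y) * q y).
  by apply: eq_Rintegral => y _; exact: d1E.
move=> cv; apply: DeriveDef.
  apply/cvg_ex; exists (\int[mu]_x (partial i phi (t *: 'e_i + x) * q x)).
  by under eq_fun do rewrite /= [_%:A]mulr1.
rewrite /derive; apply: cvg_lim => //.
by under eq_fun do rewrite /= [_%:A]mulr1.
Qed.

(** After discrete integration by parts, this is the right derivative at 0 of the integral of the
    shifted [phi] against [q]. *)
Lemma difference_quotient_smooth_cvg phi q i r :
  Ck 1 phi -> vanishes_outside r phi -> continuous q ->
  h^-1 * (\int[mu]_x (phi x * (q ((- h) *: 'e_i + x) - q x))) @[h --> 0^'+] -->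
  \int[mu]_x (q x * partial i phi x).
Proof.
move=> phi1 phi0 cq; have cphi : continuous phi by have [] := phi1.
have [dH HE] := is_derive_Rintegral_shift i 0 phi1 phi0 cq.
have -> : \int[mu]_x (q x * partial i phi x) = \int[mu]_x (partial i phi (0 *: 'e_i + x) * q x).
  by apply: eq_Rintegral => x _; rewrite scale0r add0r mulrC.
rewrite -HE; apply: cvg_trans (cvg_dnbhs_at_right dH).
apply: near_eq_cvg; near=> h.
rewrite /= -(Rintegral_difference _ _ cphi phi0 cq) addr0 [_%:A]mulr1.
rewrite [h^-1 *: _]/GRing.scale /=; congr (_ * (_ - _)).
by apply: eq_Rintegral => x _; rewrite scale0r add0r.
Unshelve. all: by end_near. Qed.

End translation.

Lemma ler_add_eps_mulr (R : realFieldType) (a b c : R) : 0 <= c ->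
  (forall e, 0 < e -> a <= b + e * c) -> a <= b.
Proof.
move=> c0 H; apply/ler_addgt0Pr => e e0.
(* Dividing by c + 1 rather than c also covers c = 0. *)
apply: le_trans (H (e / (c + 1)) _) _; first by rewrite divr_gt0 // ltr_wpDl.
by rewrite lerD2l mulrAC ler_pdivrMr ?ltr_wpDl // ler_wpM2l ?ltW // ltrDl.
Qed.

Lemma continuous_subr (R : realType) (T : topologicalType) (f g : T -> R) :
  continuous f -> continuous g -> continuous (fun x => f x - g x).
Proof.
move=> cf cg x; change {for x, continuous (f - g)}.
exact: (continuousB (cf x) (cg x)).
Qed.

Lemma continuous_mulr (R : realType) (T : topologicalType) (f g : T -> R) :
  continuous f -> continuous g -> continuous (fun x => f x * g x).
Proof. by move=> cf cg x; exact: (continuousM (cf x) (cg x)). Qed.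

(** * The chain rule for weak derivatives *)

Section chain_rule.
Context {R : realType} {d : nat}.
Implicit Types (phi psi q : 'rV[R]_d -> R) (r s t h : R).
Local Notation mu := (lebesgue_rV R d).
(** [g] is integrable on the whole space but acts as weak derivative of [f] only against functions
    supported inside radius [rho]; this fits a local derivative extended by 0. *)
Variables (i : 'I_d) (f g : 'rV[R]_d -> R) (rho : R).
Hypotheses (cf : continuous f) (ig : mu.-integrable setT (EFin \o g)).
Hypothesis fg : forall phi r, smooth phi -> vanishes_outside r phi -> r < rho ->
  \int[mu]_x (f x * partial i phi x) = - (\int[mu]_x (g x * phi x)).
Local Notation "'e" := (delta_mx ord0 i : 'rV[R]_d).
Local Notation G := (\int[mu]_x `|g x|).
Local Notation dif h := (fun x => f ((- h) *: 'e + x) - f x).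

Let cdif h : continuous (dif h).
Proof.
have cfh : continuous (fun x => f ((- h) *: 'e + x)) := @continuous_translate _ _ f i (- h) cf.
exact: continuous_subr.
Qed.

Let G_ge0 : 0 <= G. Proof. by apply: Rintegral_ge0 => x _; exact: normr_ge0. Qed.

Lemma Rintegral_mul_le psi S : continuous psi -> (forall x, `|psi x| <= S) ->
  `|\int[mu]_x (psi x * g x)| <= S * G.
Proof.
move=> cpsi psiS.
have ipg := bounded_mul_integrable cpsi psiS ig.
apply: le_trans (le_normr_Rintegral _ ipg) _ => //.
have ing : mu.-integrable setT (EFin \o (fun x => `|g x|)) by exact: integrable_norm.
rewrite -RintegralZl //; apply: le_Rintegral => //.
- exact: (integrable_norm ipg).
- by have := integrableZl measurableT S ing; congr (_.-integrable _ _).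
- by move=> x _; rewrite normrM ler_wpM2r.
Qed.

Lemma Rintegral_vanishing_le psi q r S : continuous psi -> vanishes_outside r psi ->
  (forall x, `|psi x| <= S) -> continuous q ->
  `|\int[mu]_x (psi x * q x)| <= S * \int[mu]_(x in ball 0 r) `|q x|.
Proof.
move=> cpsi psi0 psiS cq.
have iq : mu.-integrable (ball 0 r) (EFin \o (fun x => `|q x|)).
  apply: integrable_norm; exact: continuous_locally_integrable.
have ipq := integrable_mul_continuous cpsi psi0 cq.
have mB : measurable (ball (0 : 'rV[R]_d) r) by exact: measurable_rV_ball.
apply: le_trans (le_normr_Rintegral _ ipq) _ => //.
rewrite -RintegralZl // [leRHS]Rintegral_mkcond.
apply: le_Rintegral => //.
- exact: (integrable_norm ipq).
- rewrite -restrict_EFin; apply/(integrable_mkcond _ mB).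
  by have := integrableZl mB S iq; congr (_.-integrable _ _).
- move=> x _; rewrite patchE normrM; case: ifPn => [_|/negP].
    by rewrite ler_wpM2r.
  by rewrite inE ball0_normE => /negP; rewrite -leNgt => /psi0 ->; rewrite normr0 mul0r.
Qed.

(** Mean value theorem for the integral of the shifted [phi] against [f]: its derivative at t is
    minus the integral of [g] against the shifted [phi], provided that the shifted support stays
    inside radius [rho]. *)
Lemma difference_smooth_le phi r h S : smooth phi -> vanishes_outside r phi ->
  (forall x, `|phi x| <= S) -> 0 <= h -> r + h < rho ->
  `|\int[mu]_x (phi x * dif h x)| <= S * G * h.
Proof.
move=> sphi phi0 phiS h0 rh.
have cphi : continuous phi by have [] := sphi 0%N.
rewrite -(Rintegral_difference _ _ cphi phi0 cf).
pose H t := \int[mu]_x (phi (t *: 'e + x) * f x).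
have dH t : is_derive t (1 : R) H (\int[mu]_x (partial i phi (t *: 'e + x) * f x)).
  exact: is_derive_Rintegral_shift phi0 cf.
have [|t t0h HE] := @MVT_segment R H _ 0 h h0 (fun t _ => dH t).
  apply: continuous_subspaceT => t.
  by apply/differentiable_continuous/derivable1_diffP; have [] := dH t.
rewrite (_ : \int[mu]_x (phi x * f x) = H 0); last first.
  by apply: eq_Rintegral => x _; rewrite scale0r add0r.
rewrite HE subr0 normrM (ger0_norm h0) ler_wpM2r //.
have /andP[t0 th] : 0 <= t <= h by move: t0h; rewrite in_itv.
pose phit x := phi (t *: 'e + x).
have sphit : smooth phit by move=> k; exact: Ck_translate.
have phit0 : vanishes_outside (r + `|t|) phit by exact: vanishes_outside_shift.
under eq_Rintegral do rewrite -(partial_translate i phi) mulrC.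
have rt : r + `|t| < rho by apply: le_lt_trans rh; rewrite lerD2l ger0_norm.
rewrite (fg sphit phit0 rt).
rewrite normrN; under eq_Rintegral do rewrite mulrC.
by apply: Rintegral_mul_le => [|x]; [have [] := sphit 0%N|exact: phiS].
Qed.

Lemma difference_le psi r h S : continuous psi -> vanishes_outside r psi ->
  (forall x, `|psi x| <= S) -> 0 <= h -> r + 1 + h < rho ->
  `|\int[mu]_x (psi x * dif h x)| <= S * G * h.
Proof.
move=> cpsi psi0 psiS h0 rh.
set c := \int[mu]_(x in ball 0 (r + 1)) `|dif h x|.
have c0 : 0 <= c by apply: Rintegral_ge0 => x _; exact: normr_ge0.
have psi0' : vanishes_outside (r + 1) psi by apply: vanishes_outsideW psi0; rewrite lerDl.
(* For a smooth approximant at distance [e], the supremum bound grows to S + e, costing e G h, and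
   the replacement of [psi] costs e c. *)
apply: (@ler_add_eps_mulr _ _ _ (c + G * h)); first by rewrite addr_ge0 // mulr_ge0.
move=> e e0; have [phi [sphi phi0 phipsi]] := smooth_approx cpsi psi0 e0.
have cphi : continuous phi by have [] := sphi 0%N.
have phiS x : `|phi x| <= S + e.
  by rewrite -[phi x](subrK (psi x)) addrC (le_trans (ler_normD _ _)) // lerD.
have A := difference_smooth_le sphi phi0 phiS h0 rh.
have B : `|\int[mu]_x ((phi x - psi x) * dif h x)| <= e * c.
  apply: Rintegral_vanishing_le => //.
    exact: continuous_subr.
  by move=> x xr; rewrite phi0 // psi0' // subrr.
have -> : \int[mu]_x (psi x * dif h x) = \int[mu]_x (phi x * dif h x) -
    \int[mu]_x ((phi x - psi x) * dif h x).
  under [X in _ = _ - X]eq_Rintegral do rewrite mulrBl.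
  rewrite RintegralB //; first by rewrite opprB addrC subrK.
  - exact: (integrable_mul_continuous cphi phi0).
  - exact: (integrable_mul_continuous cpsi psi0).
apply: le_trans (ler_normB _ _) _; apply: le_trans (lerD A B) _.
by rewrite le_eqVlt; apply/orP; left; apply/eqP; ring.
Qed.

Lemma difference_quotient_cvg psi r : continuous psi -> vanishes_outside r psi ->
  r + 2 < rho ->
  h^-1 * (\int[mu]_x (psi x * dif h x)) @[h --> 0^'+] --> - (\int[mu]_x (psi x * g x)).
Proof.
move=> cpsi psi0 rrho; apply/cvgrPdist_le => e e0.
(* Chosen so that the three errors below, e' G, e' and e' G, add up to [e]. *)
pose e' := e / (2 * G + 1).
have G1 : 0 < 2 * G + 1 by rewrite ltr_wpDl // mulr_ge0.
have e'0 : 0 < e' by rewrite divr_gt0.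
have [phi [sphi phi0 phipsi]] := smooth_approx cpsi psi0 e'0.
have cphi : continuous phi by have [] := sphi 0%N.
have psi0' : vanishes_outside (r + 1) psi by apply: vanishes_outsideW psi0; rewrite lerDl.
have cpp : continuous (fun x => psi x - phi x).
  exact: continuous_subr.
have pp0 : vanishes_outside (r + 1) (fun x => psi x - phi x).
  by move=> x xr; rewrite phi0 // psi0' // subrr.
have ppS x : `|psi x - phi x| <= e' by rewrite distrC.
have lim_phi : h^-1 * (\int[mu]_x (phi x * dif h x)) @[h --> 0^'+] --> - (\int[mu]_x (phi x * g x)).
  have -> : - (\int[mu]_x (phi x * g x)) = \int[mu]_x (f x * partial i phi x).
    by under eq_Rintegral do rewrite mulrC; rewrite (fg sphi phi0) //; lra.
  exact: difference_quotient_smooth_cvg (sphi 1%N) phi0 cf.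
have e'e : e' * G + e' + e' * G = e by rewrite /e'; field; rewrite gt_eqF.
near=> h.
have h0 : 0 < h by [].
(* The errors come from replacing [psi] by [phi] in the limit, from the convergence for [phi]
   itself, and from the same replacement in the quotient; [difference_le] bounds the last uniformly
   in h. *)
have -> : - (\int[mu]_x (psi x * g x)) - h^-1 * (\int[mu]_x (psi x * dif h x)) =
    - (\int[mu]_x ((psi x - phi x) * g x)) +
    (- (\int[mu]_x (phi x * g x)) - h^-1 * (\int[mu]_x (phi x * dif h x))) -
    h^-1 * (\int[mu]_x ((psi x - phi x) * dif h x)).
  have [M [_ phiM]] := vanishes_outside_bounded cphi phi0.
  have [N [_ psiN]] := vanishes_outside_bounded cpsi psi0.
  under [\int[mu]_x ((psi x - phi x) * g x)]eq_Rintegral do rewrite mulrBl.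
  under [\int[mu]_x ((psi x - phi x) * dif h x)]eq_Rintegral do rewrite mulrBl.
  rewrite !RintegralB //.
  - ring.
  - exact: (integrable_mul_continuous cpsi psi0).
  - exact: (integrable_mul_continuous cphi phi0).
  - exact: bounded_mul_integrable psiN ig.
  - exact: bounded_mul_integrable phiM ig.
rewrite -e'e; apply: le_trans (ler_normB _ _) _; rewrite lerD //.
  apply: le_trans (ler_normD _ _) _; rewrite normrN lerD //.
    exact: Rintegral_mul_le.
  by near: h; move/cvgrPdist_le : lim_phi; exact.
rewrite normrM normfV (gtr0_norm h0) ler_pdivrMl // mulrC.
apply: (difference_le cpp pp0 ppS (ltW h0)).
have : h < rho - (r + 2) by near: h; apply: nbhs_right_lt; rewrite subr_gt0.
lra.
Unshelve. all: by end_near. Qed.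

Lemma weak_chain_rule (U m : 'rV[R]_d -> R) (C : R) phi r :
  continuous U -> continuous m -> 0 <= C -> r + 2 < rho ->
  (forall x y, `|x| <= r -> `|y| <= r + 1 ->
    `|U y - U x - m x * (f y - f x)| <= C * (f y - f x) ^+ 2) ->
  smooth phi -> vanishes_outside r phi ->
  \int[mu]_x (U x * partial i phi x) = - (\int[mu]_x (m x * g x * phi x)).
Proof.
move=> cU cm C0 rrho Um sphi phi0.
have cphi : continuous phi by have [] := sphi 0%N.
have cmphi : continuous (fun x => phi x * m x).
  by move=> x; exact: (continuousM (cphi x) (cm x)).
have lim_m := difference_quotient_cvg cmphi (vanishes_outsideMl m phi0) rrho.
pose dU h x := U ((- h) *: 'e + x) - U x.
have cdU h : continuous (dU h).
  have cUh : continuous (fun x => U ((- h) *: 'e + x)) by exact: continuous_translate.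
  exact: continuous_subr.
have lim_U : h^-1 * (\int[mu]_x (phi x * dU h x)) @[h --> 0^'+] -->
    \int[mu]_x (U x * partial i phi x).
  exact: difference_quotient_smooth_cvg (sphi 1%N) phi0 cU.
have [S [S0 phiS]] := vanishes_outside_bounded cphi phi0.
have lim_err : h^-1 * (\int[mu]_x (phi x * dU h x)) -
    h^-1 * (\int[mu]_x (phi x * m x * dif h x)) @[h --> 0^'+] --> (0 : R).
  apply/cvgr0Pnorm_le => e e0.
  have K0 : 0 < C * (S * G) + 1 by rewrite ltr_wpDl // !mulr_ge0.
  (* With this modulus of continuity for [f], the final bound is h e times a fraction of at most
     1. *)
  have eK : 0 < e / (C * (S * G) + 1) by rewrite divr_gt0.
  have [del del0 f_unif] := continuous_unif_ball r cf eK.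
  near=> h.
  have h0 : 0 < h by [].
  have hdel : h < del by near: h; exact: nbhs_right_lt.
  have h1 : h < 1 by near: h; exact: nbhs_right_lt.
  have hrho : h < rho - (r + 2) by near: h; apply: nbhs_right_lt; rewrite subr_gt0.
  have normhe : `|(- h) *: 'e| <= h.
    by have := norm_shift_le i (- h) 0; rewrite normr0 !addr0 normrN gtr0_norm.
  (* \int psi * dif h is \int |phi| (dif h)^2, while sup |psi| tends to 0 *)
  pose psi x := `|phi x| * dif h x.
  have cnphi : continuous (fun x => `|phi x|).
    by move=> x; apply: continuous_comp; [exact: cphi|exact: norm_continuous].
  have nphi0 : vanishes_outside r (fun x => `|phi x|) by move=> x /phi0 ->; rewrite normr0.
  have cpsi : continuous psi by apply: continuous_mulr => //; exact: cdif.
  have psi0 : vanishes_outside r psi by exact: vanishes_outsideMl.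
  have psiS x : `|psi x| <= S * (e / (C * (S * G) + 1)).
    have [xr|xr] := leP `|x| r; last first.
      by rewrite (psi0 _ (ltW xr)) normr0 mulr_ge0 // ltW.
    rewrite normrM normr_id ler_pM // distrC ltW // f_unif //.
    by rewrite opprD addrCA subrr addr0 normrN (le_lt_trans normhe).
  have P := difference_le cpsi psi0 psiS (ltW h0) ltac:(lra).
  rewrite -mulrBr normrM normfV (gtr0_norm h0) ler_pdivrMl //.
  have i1 := integrable_mul_continuous cphi phi0 (@cdU h).
  have i2 := integrable_mul_continuous cmphi (vanishes_outsideMl m phi0) (@cdif h).
  have i3 := integrable_mul_continuous cpsi psi0 (@cdif h).
  rewrite -RintegralB //.
  have i12 : mu.-integrable setT (EFin \o (fun x => phi x * dU h x - phi x * m x * dif h x)).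
    by have := integrableB measurableT i1 i2; congr (_.-integrable _ _).
  apply: le_trans (le_normr_Rintegral _ i12) _ => //.
  (* The quadratic hypothesis is used for |x| <= r and y = x - h e_i; since h < 1, this y stays
     within radius r + 1. *)
  apply: (@le_trans _ _ (C * (\int[mu]_x (psi x * dif h x)))).
    rewrite -RintegralZl //; apply: le_Rintegral => //.
    - exact: (integrable_norm i12).
    - by have := integrableZl measurableT C i3; congr (_.-integrable _ _).
    move=> x _; rewrite -mulrA -mulrBr normrM /psi -mulrA -expr2 mulrCA.
    have [xr|xr] := leP `|x| r; last first.
      by rewrite (phi0 _ (ltW xr)) normr0 !mul0r.
    rewrite ler_wpM2l //; apply: Um => //.
    apply: le_trans (ler_normD _ _) _; rewrite addrC lerD // (le_trans normhe) // ltW //.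
  apply: (@le_trans _ _ (C * (S * (e / (C * (S * G) + 1)) * G * h))).
    by rewrite ler_wpM2l // (le_trans (ler_norm _)).
  have -> : C * (S * (e / (C * (S * G) + 1)) * G * h) =
      h * e * ((C * (S * G)) / (C * (S * G) + 1)).
    by field; rewrite gt_eqF.
  rewrite -[leRHS]mulr1 ler_wpM2l //; first by rewrite mulr_ge0 ?ltW.
  by rewrite ler_pdivrMr // mul1r lerDl.
have lim0 : h^-1 * (\int[mu]_x (phi x * dU h x)) -
    h^-1 * (\int[mu]_x (phi x * m x * dif h x)) @[h --> 0^'+] -->
    \int[mu]_x (U x * partial i phi x) - - (\int[mu]_x (phi x * m x * g x)).
  exact: (cvgB lim_U lim_m).
(* The same expression tends to 0 and to the difference of the two sides of the claim. *)
have := cvg_unique (@Rhausdorff R) lim_err lim0.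
move=> /(_ _)/eqP; rewrite eq_sym subr_eq0 => /eqP ->; congr (- _).
by apply: eq_Rintegral => x _; ring.
Unshelve. all: by end_near. Qed.

End chain_rule.

(** * Local Sobolev spaces *)

Section local_Sobolev.
Context {R : realType} {d : nat}.
Implicit Types (f g phi : 'rV[R]_d -> R) (W : set 'rV[R]_d) (r p : R) (i : 'I_d).
Local Notation mu := (lebesgue_rV R d).

(** Removing the root and the indicator from the norm makes L^p membership accessible to comparison
    of integrable functions. *)
Lemma Lp_onP p W f : 0 < p -> measurable W ->
  Lp_on p W f <->
  measurable_fun W f /\ mu.-integrable W (EFin \o (fun x => `|f x| `^ p)).
Proof.
move=> p0 mW; suff E : measurable_fun W f ->
    finite_norm mu p%:E (fun x => \1_W x * f x) <->
    mu.-integrable W (EFin \o (fun x => `|f x| `^ p)).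
  by split => -[mf] /(E mf).
move=> mf; have mfp : measurable_fun W (EFin \o (fun x => `|f x| `^ p)).
  apply/measurable_EFinP; apply: (measurableT_comp (measurable_powR p)).
  exact: measurableT_comp.
have -> : finite_norm mu p%:E (fun x => \1_W x * f x) <->
    (\int[mu]_(x in W) `|(`|f x| `^ p)%:E| < +oo)%E.
  rewrite /finite_norm unlock /= [in X in _ <-> X]integral_mkcond.
  rewrite (_ : (fun x => _) = (fun x => `|(`|f x| `^ p)%:E|%E) \_ W).
    by split => [/lty_poweRy|/poweR_lty] //; apply; rewrite invr_eq0 gt_eqF.
  apply/funext => x; rewrite patchE indicE; case: ifPn => xW /=.
    by rewrite mul1r (ger0_norm (powR_ge0 _ _)).
  by rewrite mul0r normr0 powR0 // gt_eqF.
by split => [?|/integrableP[] //]; apply/integrableP.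
Qed.

Lemma Lp_on_mul p W W' f g M : 0 < p -> measurable W -> measurable W' -> W `<=` W' ->
  measurable_fun W f -> (forall x, W x -> `|f x| <= M) ->
  Lp_on p W' g -> Lp_on p W (fun x => f x * g x).
Proof.
move=> p0 mW mW' WW' mf fM /(Lp_onP _ p0 mW')[mg ig]; apply/(Lp_onP _ p0 mW).
have mgW : measurable_fun W g by exact: measurable_funS mg.
have mfg : measurable_fun W (fun x => f x * g x) by exact: measurable_funM.
split => //.
have iW : mu.-integrable W (EFin \o (fun x => `|M| `^ p * `|g x| `^ p)).
  have := integrableZl mW (`|M| `^ p) (integrableS mW' mW WW' ig).
  by congr (_.-integrable _ _).
apply: le_integrable iW => //.
  apply/measurable_EFinP; apply: (measurableT_comp (measurable_powR p)).
  exact: measurableT_comp.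
move=> x Wx; rewrite /= lee_fin ger0_norm ?powR_ge0 //
  [leRHS]ger0_norm ?mulr_ge0 ?powR_ge0 //.
rewrite -powRM // normrM; apply: ge0_ler_powR; rewrite ?nnegrE ?mulr_ge0 ?(ltW p0) //.
by rewrite ler_wpM2r // (le_trans (fM x Wx)) // ler_norm.
Qed.

Lemma Lp_on_add p W f g : 0 < p -> measurable W ->
  Lp_on p W f -> Lp_on p W g -> Lp_on p W (fun x => f x + g x).
Proof.
move=> p0 mW /(Lp_onP _ p0 mW)[mf jf] /(Lp_onP _ p0 mW)[mg jg].
apply/(Lp_onP _ p0 mW).
have mfg : measurable_fun W (fun x => f x + g x) by exact: measurable_funD.
split => //.
have iW : mu.-integrable W (EFin \o (fun x => 2 `^ p * (`|f x| `^ p + `|g x| `^ p))).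
  have := integrableZl mW (2 `^ p) (integrableD mW jf jg).
  by congr (_.-integrable _ _).
apply: le_integrable iW => //.
  apply/measurable_EFinP; apply: (measurableT_comp (measurable_powR p)).
  exact: measurableT_comp.
move=> x Wx; rewrite /= lee_fin ger0_norm ?powR_ge0 //
  [leRHS]ger0_norm ?mulr_ge0 ?addr_ge0 ?powR_ge0 //.
(* The sum is at most twice the maximum, and the p-th power of the maximum is one of the two
   summands. *)
apply: (@le_trans _ _ ((2 * Num.max `|f x| `|g x|) `^ p)).
  have M0 : 0 <= Num.max `|f x| `|g x| by rewrite le_max normr_ge0.
  apply: ge0_ler_powR; rewrite ?nnegrE ?mulr_ge0 ?(ltW p0) //.
  apply: le_trans (ler_normD _ _) _.
  by rewrite mulr_natl mulr2n lerD // le_max lexx ?orbT.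
rewrite powRM ?le_max ?normr_ge0 // ler_wpM2l ?powR_ge0 //.
by case: (leP `|f x| `|g x|) => _; rewrite ?lerDl ?lerDr powR_ge0.
Qed.

Lemma Lp_on_cst p W c : 0 < p -> measurable W -> (mu W < +oo)%E ->
  Lp_on p W (fun=> c).
Proof.
move=> p0 mW Woo; apply/(Lp_onP _ p0 mW); split; first exact: measurable_cst.
apply: measurable_bounded_integrable => //.
exists (`|c| `^ p); split; first exact: num_real.
by move=> N cN x _; rewrite /= ger0_norm ?powR_ge0 // ltW.
Qed.

(** On a set of finite measure |f| is dominated by the integrable function 1 + |f|^p. *)
Lemma Lp_on_integrable p W f : 1 <= p -> measurable W -> (mu W < +oo)%E ->
  Lp_on p W f -> mu.-integrable W (EFin \o f).
Proof.
move=> p1 mW Woo; have p0 : 0 < p by exact: lt_le_trans p1.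
move=> /(Lp_onP _ p0 mW)[mf jf].
have i1 : mu.-integrable W (EFin \o (fun x => 1 + `|f x| `^ p)).
  have j1 : mu.-integrable W (EFin \o cst 1).
    apply: measurable_bounded_integrable => //; exists 1; split => // N N1 x _ /=.
    by rewrite normr1 ltW.
  have := integrableD mW j1 jf.
  by congr (_.-integrable _ _).
apply: le_integrable i1 => //; first exact/measurable_EFinP.
move=> x Wx; rewrite /= lee_fin [leRHS]ger0_norm ?addr_ge0 ?powR_ge0 //.
have [f1|f1] := leP `|f x| 1; first by rewrite ler_wpDr ?powR_ge0.
by rewrite ler_wpDl // le1r_powR // ltW.
Qed.

Lemma bounded_set_ball W : bounded_set W -> exists2 r, 0 < r & W `<=` ball 0 r.
Proof.
move=> [M [_ WM]]; exists (`|M| + 2); first by rewrite ltr_wpDl.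
move=> x Wx; rewrite ball0_normE; apply: (@le_lt_trans _ _ (`|M| + 1)).
  by apply: WM => //; rewrite ltr_pwDr // ler_norm.
by rewrite ltrD2l ltr1n.
Qed.

Lemma bounded_set_lebesgue_fin W : measurable W -> bounded_set W -> (mu W < +oo)%E.
Proof.
move=> mW /bounded_set_ball[r _ Wr].
apply: (@le_lt_trans _ _ (mu (ball 0 r))); last exact: lebesgue_rV_ball_fin.
by apply: le_measure => //; rewrite inE //; exact: measurable_rV_ball.
Qed.

Lemma bounded_set_ball0 r : bounded_set (ball (0 : 'rV[R]_d) r).
Proof.
exists r; split; first exact: num_real.
by move=> M rM x; rewrite /= ball0_normE => xr; apply/ltW/(lt_trans xr).
Qed.

Lemma test_fun_eq0 W phi x : test_fun W phi -> ~ W x -> phi x = 0.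
Proof.
move=> [_ _ sW] Wx; apply/eqP/negPn/negP => phix; apply: Wx; apply: sW.
exact: subset_closure.
Qed.

Lemma test_fun_partial_eq0 W phi i x : test_fun W phi -> ~ W x -> partial i phi x = 0.
Proof.
move=> [_ _ sW] Wx.
rewrite /partial (_ : 0 = 'D_(delta_mx ord0 i) (cst (0 : R)) x); last by rewrite derive_cst.
apply: near_eq_derive.
have : nbhs x (~` closure [set y | phi y != 0]).
  apply: open_nbhs_nbhs; split; last by move/sW.
  by rewrite openC; exact: closed_closure.
apply: filterS => y; apply: contra_notP => /eqP phiy; exact: subset_closure.
Qed.

Lemma vanishes_outside_test_fun phi r rho : smooth phi -> vanishes_outside r phi ->
  r < rho -> test_fun (ball 0 rho) phi.
Proof.
move=> sphi phi0 rrho.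
have supp : closure [set x | phi x != 0] `<=` [set x | `|x| <= r].
  have : closed [set x : 'rV[R]_d | `|x| <= r].
    by apply: compact_closed; [exact: norm_hausdorff|exact: compact_norm_le].
  move=> /closure_id ->; apply: closure_subset => x /=.
  by apply: contra_neqT; rewrite -ltNge => /ltW /phi0.
split => //.
  by apply: subclosed_compact supp; [exact: closed_closure|exact: compact_norm_le].
by move=> x /supp /= xr; rewrite ball0_normE; exact: le_lt_trans rrho.
Qed.

Lemma Rintegral_eq_support W f : (forall x, ~ W x -> f x = 0) ->
  \int[mu]_(x in W) f x = \int[mu]_x f x.
Proof.
move=> f0; rewrite Rintegral_mkcond; apply: eq_Rintegral => x _.
by rewrite patchE; case: ifPn => // /negP; rewrite inE => /f0 ->.
Qed.

(* [m] plays the role of F' o f when U = F o f. *)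
Lemma H1p_loc_comp p f (U m : 'rV[R]_d -> R) : 1 <= p ->
  continuous f -> continuous U -> continuous m ->
  (forall r, exists2 C, 0 <= C & forall x y, `|x| <= r -> `|y| <= r ->
    `|U y - U x - m x * (f y - f x)| <= C * (f y - f x) ^+ 2) ->
  H1p_loc p f -> H1p_loc p U.
Proof.
move=> p1 cf cU cm HU Hf W oW bW; have p0 : 0 < p by exact: lt_le_trans p1.
have mW := measurable_open_rV oW.
have [r r0 Wr] := bounded_set_ball bW.
have cW (q : 'rV[R]_d -> R) : continuous q -> measurable_fun W q.
  by move=> cq; apply: measurable_funTS; exact: continuous_rV_measurable.
have bdW (q : 'rV[R]_d -> R) : continuous q -> exists M, forall x, W x -> `|q x| <= M.
  move=> /(@continuous_bounded_ball _ _ q r)[M [_ qM]]; exists M => x /Wr.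
  by rewrite ball0_normE => /ltW/qM.
split.
  have [M UM] := bdW U cU.
  have := @Lp_on_mul p W W U (fun=> 1) M p0 mW mW (@subset_refl _ W) (cW U cU) UM.
  move=> /(_ (Lp_on_cst 1 p0 mW (bounded_set_lebesgue_fin mW bW))).
  by under eq_fun do rewrite mulr1.
(* The weak derivative of [f] is taken on a larger ball, as the chain rule for supports of radius
   [r] needs a radius above r + 2. *)
move=> i; pose W' : set 'rV[R]_d := ball 0 (r + 4).
have oW' : open W' by exact: ball_open.
have mW' := measurable_open_rV oW'.
have WW' : W `<=` W'.
  by apply: subset_trans Wr _; apply: le_ball; rewrite lerDl.
have [_ /(_ i)[g [Lg fg]]] := Hf W' oW' (@bounded_set_ball0 _).
have [M mM] := bdW m cm.
exists (fun x => m x * g x); split; first exact: (Lp_on_mul p0 mW mW' WW' (cW m cm) mM Lg).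
(* Extension by 0 makes the local derivative integrable on the whole space. *)
pose g' := g \_ W'.
have ig' : mu.-integrable setT (EFin \o g').
  rewrite -restrict_EFin; apply/(integrable_mkcond _ mW').
  apply: Lp_on_integrable Lg => //.
  exact: bounded_set_lebesgue_fin mW' (@bounded_set_ball0 _).
have fg' phi s : smooth phi -> vanishes_outside s phi -> s < r + 4 ->
    \int[mu]_x (f x * partial i phi x) = - (\int[mu]_x (g' x * phi x)).
  move=> sphi phi0 sr; have tphi := vanishes_outside_test_fun sphi phi0 sr.
  rewrite -(@Rintegral_eq_support W'); last first.
    by move=> x /(test_fun_partial_eq0 i tphi) ->; rewrite mulr0.
  rewrite (fg _ tphi) -(@Rintegral_eq_support W'); last first.
    by move=> x /(test_fun_eq0 tphi) ->; rewrite mulr0.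
  by congr (- _); apply: eq_Rintegral => x xW; rewrite /g' patchE xW.
move=> phi tphi; have [sphi _ _] := tphi.
have phi0 : vanishes_outside r phi.
  move=> x rx; apply: test_fun_eq0 tphi _ => /Wr.
  by rewrite ball0_normE ltNge rx.
rewrite Rintegral_eq_support; last first.
  by move=> x /(test_fun_partial_eq0 i tphi) ->; rewrite mulr0.
have [C C0 UC] := HU (r + 1).
rewrite (@weak_chain_rule _ _ i f g' (r + 4) cf ig' fg' U m C phi r) //; last 2 first.
- by rewrite ltrD2l ltr_nat.
- by move=> x y xr yr; apply: UC => //; rewrite (le_trans xr) // lerDl.
rewrite -(@Rintegral_eq_support W); last first.
  by move=> x /(test_fun_eq0 tphi) ->; rewrite mulr0.
congr (- _); apply: eq_Rintegral => x; rewrite inE => /WW' xW.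
by rewrite /g' patchE mem_set.
Qed.

Lemma H1p_loc_add p f g : 1 <= p ->
  H1p_loc p f -> H1p_loc p g -> H1p_loc p (fun x => f x + g x).
Proof.
move=> p1 Hf Hg W oW bW; have p0 : 0 < p by exact: lt_le_trans p1.
have mW := measurable_open_rV oW.
have Woo := bounded_set_lebesgue_fin mW bW.
have [[Lf df] [Lg dg]] := (Hf W oW bW, Hg W oW bW).
split; first exact: Lp_on_add.
move=> i; have [[f' [Lf' ff']] [g' [Lg' gg']]] := (df i, dg i).
exists (fun x => f' x + g' x); split; first exact: Lp_on_add.
move=> phi tphi; have [sphi _ _] := tphi.
have [r _ Wr] := bounded_set_ball bW.
have phi0 : vanishes_outside r phi.
  move=> x rx; apply: test_fun_eq0 tphi _ => /Wr.
  by rewrite ball0_normE ltNge rx.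
have [cphi dphi] := sphi 1%N; have [_ [cdphi _]] := dphi i.
have dphi0 : vanishes_outside (r + 1) (partial i phi).
  by apply: vanishes_outside_partial phi0; rewrite ltrDl.
have iM h psi s : Lp_on p W h -> continuous psi -> vanishes_outside s psi ->
    mu.-integrable W (EFin \o (fun x => h x * psi x)).
  move=> Lh cpsi psi0; have [M [_ psiM]] := vanishes_outside_bounded cpsi psi0.
  have ih := Lp_on_integrable p1 mW Woo Lh.
  apply: (integrableMl mW ih); first by apply: measurable_funTS; exact: continuous_rV_measurable.
  exists M; split; first exact: num_real.
  by move=> N MN x _; apply: le_trans (psiM x) _; exact: ltW.
under eq_Rintegral do rewrite mulrDl.
under [in RHS]eq_Rintegral do rewrite mulrDl.
rewrite !RintegralD //; try by [apply: iM cdphi dphi0|apply: iM cphi phi0].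
by rewrite (ff' _ tphi) (gg' _ tphi) opprD.
Qed.

End local_Sobolev.

(** * Stability of the continuous functions in H^{1,p}_loc *)

Section algebra_of_H1p_loc.
Context {R : realType} {d : nat}.
Implicit Types (f g : 'rV[R]_d -> R).
Variable p : R.
Hypothesis p1 : 1 <= p.
Let C f := H1p_loc p f /\ continuous f.

Lemma H1p_loc_scale c f : C f -> C (fun x => c * f x).
Proof.
move=> [Hf cf]; have cc : continuous (fun _ : 'rV[R]_d => c) by move=> x; exact: cst_continuous.
have cU : continuous (fun x => c * f x) by exact: continuous_mulr.
split => //; apply: (H1p_loc_comp p1 cf cU cc _ Hf) => r; exists 0 => // x y _ _.
by rewrite -!mulrBr subrr mulr0 normr0 mul0r.
Qed.

Lemma H1p_loc_sub f g : C f -> C g -> C (fun x => f x - g x).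
Proof.
move=> Cf Cg; have [[Hf cf] [Hg cg]] := (Cf, H1p_loc_scale (-1) Cg).
split; last by apply: continuous_subr; [case: Cf|case: Cg].
have := H1p_loc_add p1 Hf Hg.
by rewrite (_ : (fun x => f x + _) = fun x => f x - g x) //; apply/funext => x; rewrite mulN1r.
Qed.

Lemma H1p_loc_sqr f : C f -> C (fun x => f x ^+ 2).
Proof.
move=> Cf; have [Hf cf] := Cf; have [_ c2f] := H1p_loc_scale 2 Cf.
have cU : continuous (fun x => f x ^+ 2).
  by under eq_fun do rewrite expr2; exact: continuous_mulr.
split => //; apply: (H1p_loc_comp p1 cf cU c2f _ Hf) => r; exists 1 => // x y _ _.
rewrite mul1r (_ : _ - _ - _ = (f y - f x) ^+ 2); last by ring.
by rewrite ger0_norm // sqr_ge0.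
Qed.

Lemma H1p_loc_mul f g : C f -> C g -> C (fun x => f x * g x).
Proof.
(* polarization: 4 f g = (f + g)^2 - (f - g)^2 *)
move=> Cf Cg; have Cfg := H1p_loc_sub Cf (H1p_loc_scale (-1) Cg).
have := H1p_loc_scale (4^-1) (H1p_loc_sub (H1p_loc_sqr Cfg) (H1p_loc_sqr (H1p_loc_sub Cf Cg))).
rewrite (_ : (fun x => 4^-1 * _) = fun x => f x * g x) //.
by apply/funext => x; field.
Qed.

Lemma H1p_loc_inv f : (forall x, 0 < f x) -> C f -> C (fun x => (f x)^-1).
Proof.
move=> f0 [Hf cf].
have fn0 x : f x != 0 by rewrite gt_eqF.
have cU : continuous (fun x => (f x)^-1) by move=> x; apply: continuousV => //; exact: cf.
have cm : continuous (fun x => (-1) * ((f x)^-1 * (f x)^-1)).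
  apply: continuous_mulr; first by move=> x; exact: cst_continuous.
  exact: continuous_mulr.
split => //; apply: (H1p_loc_comp p1 cf cU cm _ Hf) => r.
have [M [M0 fM]] := @continuous_bounded_ball _ _ _ r cU.
exists (M * M * M); first by rewrite !mulr_ge0.
move=> x y xr yr.
(* The remainder is exactly quadratic, with a coefficient bounded by M^3 because 1/f is bounded on
   the ball. *)
rewrite (_ : _ - _ - _ = (f x)^-1 * (f x)^-1 * (f y)^-1 * (f y - f x) ^+ 2); last first.
  by field; rewrite !fn0.
rewrite normrM [`|_ ^+ 2|]ger0_norm ?sqr_ge0 // ler_wpM2r ?sqr_ge0 //.
by rewrite !normrM !ler_pM ?mulr_ge0 ?fM.
Qed.

Lemma H1p_loc_sqrt f : (forall x, 0 < f x) -> C f -> C (fun x => Num.sqrt (f x)).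
Proof.
move=> f0 [Hf cf].
have s0 x : 0 < Num.sqrt (f x) by rewrite sqrtr_gt0.
have cU : continuous (fun x => Num.sqrt (f x)).
  by move=> x; apply: continuous_comp; [exact: cf|exact: sqrt_continuous].
have cV : continuous (fun x => (Num.sqrt (f x))^-1).
  by move=> x; apply: (@continuousV _ _ (fun x => Num.sqrt (f x))); [rewrite gt_eqF|exact: cU].
have cm : continuous (fun x => 2^-1 * (Num.sqrt (f x))^-1).
  by apply: continuous_mulr => //; move=> x; exact: cst_continuous.
split => //; apply: (H1p_loc_comp p1 cf cU cm _ Hf) => r.
have [M [M0 fM]] := @continuous_bounded_ball _ _ _ r cV.
exists (M * M * M); first by rewrite !mulr_ge0.
move=> x y xr yr; have [sx sy] := (s0 x, s0 y).
have {}fM : (Num.sqrt (f x))^-1 <= M by apply: le_trans (fM x xr); exact: ler_norm.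
have -> : f y - f x = Num.sqrt (f y) ^+ 2 - Num.sqrt (f x) ^+ 2.
  by rewrite !sqr_sqrtr ?ltW.
move: sx sy fM; move: (Num.sqrt (f x)) (Num.sqrt (f y)) => a b a0 b0 aM.
(* With a and b the square roots at x and y, the remainder is quadratic in b - a, while the claim is
   quadratic in (b + a)(b - a). The missing factor is supplied by 1/2 <= (1 + b/a)^2. *)
rewrite (_ : _ - _ - _ = - (2^-1 * a^-1 * (b - a) ^+ 2)); last by field; rewrite gt_eqF.
have aV0 : 0 <= a^-1 by rewrite invr_ge0 ltW.
have h0 : 0 <= 2^-1 * a^-1 * (b - a) ^+ 2.
  by rewrite mulr_ge0 ?sqr_ge0 // mulr_ge0 // invr_ge0 ler0n.
rewrite normrN (ger0_norm h0).
rewrite (_ : b ^+ 2 - a ^+ 2 = (b + a) * (b - a)); last by ring.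
rewrite exprMn [leRHS]mulrA ler_wpM2r ?sqr_ge0 //.
apply: (@le_trans _ _ (a^-1 * a^-1 * a^-1 * (b + a) ^+ 2)); last first.
  rewrite ler_wpM2r ?sqr_ge0 //; apply: ler_pM => //; [exact: mulr_ge0|exact: ler_pM].
have -> : a^-1 * a^-1 * a^-1 * (b + a) ^+ 2 = a^-1 * (1 + b / a) ^+ 2.
  by field; rewrite gt_eqF.
rewrite [leLHS]mulrC ler_wpM2l //.
by have := divr_gt0 b0 a0; move: (b / a) => z; nra.
Qed.

End algebra_of_H1p_loc.

(** * Positive definiteness and conclusion *)

Lemma elliptic_posdef (R : realType) (d : nat) (A : 'rV[R]_d -> 'M[R]_d) :
  (forall x, (A x)^T = A x) -> loc_unif_strictly_elliptic A ->
  forall x (v : 'rV[R]_d), v != 0 -> 0 < (v *m A x *m v^T) 0 0.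
Proof.
(* Ellipticity on the unit ball around [x] bounds the form at [x] below by [lam] times the squared
   Euclidean norm. *)
move=> symA ellA x v v0; have [lam [Lam [lam0 _ H]]] := ellA x 1 ltr01.
have /(H x v)/andP[Hv _] : eball x 1 x.
  by rewrite /eball /= subrr /dotr big1 ?expr1n // => i _; rewrite mxE mul0r.
have vv : 0 < dotr v v.
  have [j vj] := rV0Pn _ v0.
  rewrite /dotr (bigD1 j) //= ltr_pwDl //.
    by rewrite -expr2 exprn_even_gt0.
  by apply: sumr_ge0 => i _; rewrite -expr2 sqr_ge0.
apply: lt_le_trans (mulr_gt0 lam0 vv) (le_trans Hv _).
rewrite symA /dotr [leRHS]mxE le_eqVlt; apply/orP; left; apply/eqP.
by apply: eq_bigr => j _; rewrite [v^T _ _]mxE.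
Qed.

Theorem theorem4p1 (R : realType) (d : nat) (p : R)
    (A : 'rV[R]_d -> 'M[R]_d) :
  (2 <= d)%N ->
  d%:R < p ->
  (forall x, (A x)^T = A x) ->
  (forall i j, H1p_loc p (fun x => A x i j) /\
               continuous (fun x => A x i j)) ->
  loc_unif_strictly_elliptic A ->
  exists! sigma : 'rV[R]_d -> 'M[R]_d,
    [/\ forall x, is_trig_mx (sigma x),
        forall i j, H1p_loc p (fun x => sigma x i j) /\
                    continuous (fun x => sigma x i j),
        forall i x, 0 < sigma x i i
      & forall x, A x = sigma x *m (sigma x)^T].
Proof.
move=> d2 dp symA HA ellA.
have p1 : 1 <= p by apply/ltW/(le_lt_trans _ dp); rewrite ler1n (ltn_trans _ d2).
pose i0 := Ordinal (ltnW d2).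
have C0 : H1p_loc p (fun _ : 'rV[R]_d => 0) /\ continuous (fun _ : 'rV[R]_d => 0 : R).
  (* The zero function arises as an entry of [A] minus itself. *)
  have := H1p_loc_sub p1 (HA i0 i0) (HA i0 i0).
  by rewrite (_ : (fun x => _ - _) = fun=> 0) //; apply/funext => x; rewrite subrr.
have [sigma [trig Hs pos AE]] := cholesky_in_class C0 (H1p_loc_sub p1)
  (H1p_loc_mul p1) (H1p_loc_inv p1) (H1p_loc_sqrt p1) symA
  (elliptic_posdef symA ellA) HA.
(* Uniqueness is pointwise, by uniqueness of the Cholesky factor of the matrix [A x]. *)
exists sigma; split => // tau [trig' _ pos' AE']; apply/funext => x.
by apply: cholesky_unique => //; rewrite -AE.
Qed.
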